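(* Let $n,l,m$ be positive integers and $T\in(0,+\infty)$. Assume: (A1) $A\in C([0,T];\mathbb{R}^{n\times n})$, $B\in C([0,T];\mathbb{R}^{n\times l})$, $S\in C([0,T];\mathbb{R}^{n\times l})$, $Q\in C([0,T];S^n_{>0})$ and $R\in C([0,T];S^l_{>0})$; and for each $i\in\{1,\dots,m\}$, $G_i\in S^n_{\ge 0}$, $a_i\in\mathbb{R}^n$ and $b_i\in\mathbb{R}$ are constant. (A2) The functions $$C_{pp}(t)=B(t)R(t)^{-1}B(t)^T,\quad C_{xx}(t)=Q(t)-S(t)R(t)^{-1}S(t)^T,\quad C_{xp}(t)=A(t)-B(t)R(t)^{-1}S(t)^T$$ satisfy $C_{pp}(t)\in S^n_{\ge0}$, $C_{xx}(t)\in S^n_{>0}$ and $C_{xp}(t)\in\mathbb{R}^{n\times n}$ for all $t\in[0,T]$. Let $x_0\in\mathbb{R}^n$ and $t_0\in[0,T]$, and consider the optimal control problem $$\inf_{(x,u)\in\mathcal{C}(t_0,x_0)}\left\{\int_{t_0}^T\Big(\tfrac12x(s)^TQ(s)x(s)+\tfrac12u(s)^TR(s)u(s)+x(s)^TS(s)u(s)\Big)ds+\Psi(x(T))\right\},\qquad(\ast)$$ with $$\Psi(x)=\min_{i\in\{1,\dots,m\}}\left\{\tfrac12x^TG_ix+a_i^Tx+b_i\right\},$$ where $\mathcal{C}(t_0,x_0)$ is the set of $(x(\cdot),u(\cdot))\in L^2(t_0,T;\mathbb{R}^n)\times L^2(t_0,T;\mathbb{R}^l)$ satisfying $\dot x(s)=A(s)x(s)+B(s)u(s)$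 for $s\in(t_0,T)$ and $x(t_0)=x_0$. Let $u^*\colon[t_0,T]\to\mathbb{R}^l$ be a feasible control, and let $x^*\in C([t_0,T];\mathbb{R}^n)$ be the solution of the Cauchy problem $\dot x(s)=A(s)x(s)+B(s)u^*(s)$, $s\in(t_0,T)$, $x(t_0)=x_0$. Then $u^*$ is an optimal control in problem $(\ast)$ if and only if there exists an index $$k\in\operatorname*{arg\,min}_{i\in\{1,\dots,m\}}\left\{\tfrac12x_0^TP_i(t_0)x_0+q_i(t_0)^Tx_0+r_i(t_0)\right\}$$ such that $$u^*(t)=u_k(t,x^*(t))\quad\text{for almost every } t\in[t_0,T],$$ where $$u_k(t,x)=-R(t)^{-1}\left(B(t)^TP_k(t)x+B(t)^Tq_k(t)+S(t)^Tx\right),\qquad t\in[t_0,T],\ x\in\mathbb{R}^n.$$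
   Context: $S^n$ denotes the real symmetric $n\times n$ matrices; $S^n_{>0}$ and $S^n_{\ge0}$ denote the symmetric positive definite and symmetric positive semi-definite $n\times n$ matrices (similarly $S^l_{>0}$ for $l\times l$). $C([0,T];E)$ denotes the continuous functions from $[0,T]$ to $E$. For each $i\in\{1,\dots,m\}$, the functions $P_i\in C([0,T];S^n)$, $q_i\in C([0,T];\mathbb{R}^n)$, $r_i\in C([0,T];\mathbb{R})$ are the solutions on $(0,T)$ of the final value problems $$\dot P_i(t)=P_i(t)^TC_{pp}(t)P_i(t)-P_i(t)^TC_{xp}(t)-C_{xp}(t)^TP_i(t)-C_{xx}(t),\quad P_i(T)=G_i,$$ $$\dot q_i(t)=P_i(t)^TC_{pp}(t)q_i(t)-C_{xp}(t)^Tq_i(t),\quad q_i(T)=a_i,$$ $$\dot r_i(t)=\tfrac12 q_i(t)^TC_{pp}(t)q_i(t),\quad r_i(T)=b_i.$$ A feasible control is a $u\in L^2(t_0,T;\mathbb{R}^l)$ for which, with its trajectory $x$, one has $(x,u)\in\mathcal{C}(t_0,x_0)$. Trajectories are absolutely continuous and solve the differential equation almost everywhere. A feasible control is optimal if it, together with its trajectory, attains the infimum in $(\ast)$. *)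

(* Defs.v *)
From HB Require Import structures.
From mathcomp Require Import all_boot all_order all_algebra.
From mathcomp Require Import all_classical all_reals all_analysis.

Set Implicit Arguments.
Unset Strict Implicit.
Unset Printing Implicit Defensive.

Import Order.TTheory GRing.Theory Num.Theory.
Import numFieldNormedType.Exports.

Local Open Scope classical_set_scope.
Local Open Scope ring_scope.

(* All functions of time are total functions on R, of which only the values on
   [0, T] (or on [t0, T]) matter; column vectors 'cV_n stand for R^n. *)

Section linear_algebra.
Context {R : realType}.

Definition dotv n (a x : 'cV[R]_n) : R := (a^T *m x) 0 0.

Definition bform n l (x : 'cV[R]_n) (M : 'M[R]_(n, l)) (u : 'cV[R]_l) : R :=
  (x^T *m M *m u) 0 0.

Definition symmx n : set 'M[R]_n := [set M | M^T = M].

Definition possemidefmx n : set 'M[R]_n :=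
  [set M | M^T = M /\ forall x : 'cV[R]_n, 0 <= bform x M x].

Definition posdefmx n : set 'M[R]_n :=
  [set M | M^T = M /\ forall x : 'cV[R]_n, x != 0 -> 0 < bform x M x].

Definition quad n (M : 'M[R]_n) (a : 'cV[R]_n) (b : R) (x : 'cV[R]_n) : R :=
  2^-1 * bform x M x + dotv a x + b.

End linear_algebra.

Section functions_of_time.
Context {R : realType}.
Notation mu := (@lebesgue_measure R).

(* C([0, T]; E), for a subset E of a topological space. *)
Definition cont_into (V : topologicalType) (T : R) (E : set V) (f : R -> V) :=
  {within `[0, T], continuous f} /\
  forall t : R, t \in `[0, T] -> E (f t).

Definition abs_continuous (V : normedModType R) (a b : R) (f : R -> V) :=
  forall e : R, 0 < e -> exists2 d : R, 0 < d &
    forall (N : nat) (c : 'I_N -> R * R),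
      (forall k, a <= (c k).1 /\ (c k).1 <= (c k).2 /\ (c k).2 <= b) ->
      trivIset [set: 'I_N] (fun k => `](c k).1, (c k).2[%classic) ->
      \sum_(k < N) ((c k).2 - (c k).1) < d ->
      \sum_(k < N) `|f (c k).2 - f (c k).1| < e.

(* L^2(a, b; R^n). Library measurability is Borel measurability, so we only ask
   that each coordinate agree almost everywhere on (a, b) with an element of
   L^2(R): this amounts to Lebesgue measurability together with square
   integrability on (a, b). *)
Definition L2 n (a b : R) (f : R -> 'cV[R]_n) :=
  forall j, exists2 g : R -> R, g \in Lfun mu 2%:E &
    {ae mu, forall t : R, t \in `]a, b[ -> f t j 0 = g t}.

End functions_of_time.

Section control_problem.
Context {R : realType} (n l : nat).
Notation mu := (@lebesgue_measure R).
Variables (A : R -> 'M[R]_n) (B : R -> 'M[R]_(n, l)) (S : R -> 'M[R]_(n, l))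
  (Q : R -> 'M[R]_n) (Rm : R -> 'M[R]_l).

Definition Cpp t : 'M[R]_n := B t *m invmx (Rm t) *m (B t)^T.
Definition Cxx t : 'M[R]_n := Q t - S t *m invmx (Rm t) *m (S t)^T.
Definition Cxp t : 'M[R]_n := A t - B t *m invmx (Rm t) *m (S t)^T.

Definition riccati_solution (T : R) (G : 'M[R]_n) (a : 'cV[R]_n) (b : R)
    (P : R -> 'M[R]_n) (q : R -> 'cV[R]_n) (r : R -> R) :=
  [/\ [/\ cont_into T (@symmx R n) P, cont_into T setT q & cont_into T setT r],
      forall t : R, t \in `]0, T[ ->
        is_derive t 1 P ((P t)^T *m Cpp t *m P t - (P t)^T *m Cxp t
                         - (Cxp t)^T *m P t - Cxx t),
      forall t : R, t \in `]0, T[ ->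
        is_derive t 1 q ((P t)^T *m Cpp t *m q t - (Cxp t)^T *m q t),
      forall t : R, t \in `]0, T[ ->
        is_derive t 1 r (2^-1 * bform (q t) (Cpp t) (q t))
    & [/\ P T = G, q T = a & r T = b]].

Definition feedback (P : R -> 'M[R]_n) (q : R -> 'cV[R]_n) (t : R)
    (x : 'cV[R]_n) : 'cV[R]_l :=
  - (invmx (Rm t) *m ((B t)^T *m P t *m x + (B t)^T *m q t + (S t)^T *m x)).

Definition trajectory (T t0 : R) (x0 : 'cV[R]_n)
    (x : R -> 'cV[R]_n) (u : R -> 'cV[R]_l) :=
  [/\ abs_continuous t0 T x,
      {ae mu, forall s : R, s \in `]t0, T[ ->
        is_derive s 1 x (A s *m x s + B s *m u s)}
    & x t0 = x0].

Definition feasible (T t0 : R) (x0 : 'cV[R]_n) :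
    set ((R -> 'cV[R]_n) * (R -> 'cV[R]_l)) :=
  [set z | [/\ L2 t0 T z.1, L2 t0 T z.2 & trajectory T t0 x0 z.1 z.2]].

Definition feasible_control (T t0 : R) (x0 : 'cV[R]_n) (u : R -> 'cV[R]_l) :=
  exists x, feasible T t0 x0 (x, u).

Variables (m : nat) (G : 'I_m.+1 -> 'M[R]_n) (a : 'I_m.+1 -> 'cV[R]_n)
  (b : 'I_m.+1 -> R).

(* The pieces are indexed by 'I_m.+1, so the minimum is over a nonempty set; the
   seed of the iterated minimum is one of its members. *)
Definition Psi (x : 'cV[R]_n) : R :=
  \big[Num.min/quad (G ord0) (a ord0) (b ord0) x]_(i < m.+1)
    quad (G i) (a i) (b i) x.

(* Controls are only almost everywhere Borel, and the integral below does not
   ask for measurability: it is defined from the simple functions lying below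
   the positive and negative parts, so null sets do not affect it. *)
Definition cost (T t0 : R) (z : (R -> 'cV[R]_n) * (R -> 'cV[R]_l)) : \bar R :=
  (\int[mu]_(s in `[t0, T])
     (2^-1 * bform (z.1 s) (Q s) (z.1 s) + 2^-1 * bform (z.2 s) (Rm s) (z.2 s)
      + bform (z.1 s) (S s) (z.2 s))%:E
   + (Psi (z.1 T))%:E)%E.

Definition optimal_control (T t0 : R) (x0 : 'cV[R]_n) (u : R -> 'cV[R]_l) :=
  exists2 x, feasible T t0 x0 (x, u) &
    cost T t0 (x, u) = ereal_inf (cost T t0 @` feasible T t0 x0).

End control_problem.

(* Main.v *)
(** Along a trajectory, the value function V_i(t, x) of the i-th quadratic
terminal cost satisfies, by the Riccati equations and completion of squares,
d/dt V_i(t, x(t)) + L(t, x, u) = 1/2 |u - u_i(t, x)|^2_R for almost every t.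
Integrating, the cost of (x, u) for the i-th terminal cost alone is V_i(t0, x0)
plus the nonnegative excess 1/2 int |u - u_i|^2_R. As the terminal cost is a
minimum, the infimum of the problem is the least V_k(t0, x0): it is attained by
the closed-loop trajectory of u_k, which exists by Picard iteration, and any
optimal control has zero excess for an index attaining the terminal minimum.

The integration step is the fundamental theorem of calculus for absolutely
continuous functions. It follows from Lebesgue's differentiation theorem once
an absolutely continuous function with almost everywhere nonpositive derivative
is known to be nonincreasing. That is shown by real induction: outside an open
set U of small measure containing the exceptional null set, the increments are
controlled by the derivative, and the increments inside U are small by absolute
continuity. *)

Require Import Defs.
From HB Require Import structures.
From mathcomp Require Import all_boot all_order all_algebra.
From mathcomp Require Import all_classical all_reals all_analysis.
From mathcomp Require Import measurable_realfun ring lra.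

Set Implicit Arguments.
Unset Strict Implicit.
Unset Printing Implicit Defensive.

Import Order.TTheory GRing.Theory Num.Theory.
Import numFieldNormedType.Exports.

Local Open Scope classical_set_scope.
Local Open Scope ring_scope.

(** * Almost everywhere equality and real induction *)

Section ae_integral.
Context d (T : measurableType d) (R : realType) (mu : {measure set T -> \bar R}).
Local Open Scope ereal_scope.

Import HBNNSimple.
(** For nonnegative [F] the integral unfolds to this supremum over simple functions, whether or not
    [F] is measurable. *)
Let nnint (F : T -> \bar R) := ereal_sup [set sintegral mu h |
    h in [set h : {nnsfun T >-> R} | forall x, (h x)%:E <= F x]].

Let nnint_le (N : set T) (F G : T -> \bar R) : measurable N -> mu N = 0 ->
  (forall x, 0 <= G x) -> (forall x, ~ N x -> F x <= G x) ->
  nnint F <= nnint G.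
Proof.
move=> mN N0 G0 FG; apply: ge_ereal_sup => _ /= [h hF <-].
have mNC : measurable (~` N) by exact: measurableC.
pose h' := mul_nnsfun h (indic_nnsfun R mNC).
have h'E x : h' x = (h x * \1_(~` N) x)%R by [].
have -> : sintegral mu h = sintegral mu h'.
  rewrite -!integralT_nnsfun; apply: ge0_ae_eq_integral => //.
  - exact/measurable_EFinP.
  - exact/measurable_EFinP.
  - by move=> x _; rewrite lee_fin.
  - by move=> x _; rewrite lee_fin.
  - exists N; split => // x /= hx; apply: contrapT => Nx; apply: hx => _.
    by rewrite [RHS](_ : _ = (h x * \1_(~` N) x)%:E)%R// indicE mem_set ?mulr1.
apply: ereal_sup_ubound; exists h' => //= x.
rewrite [X in (X <= _)%E](_ : _ = (h x * \1_(~` N) x)%:E)%R// indicE.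
have [Nx|Nx] := pselect (N x).
  by rewrite memNset ?mulr0//; exact.
by rewrite mem_set// mulr1 (le_trans (hF x))// FG.
Qed.

(* Neither function need be measurable: multiplying the simple functions below
   [f] by the indicator of the complement of a null set does not change their
   integral, and makes them lie below [g]. *)
Lemma ae_eq_integral_nonmeasurable (D : set T) (f g : T -> \bar R) :
  ae_eq mu D f g -> \int[mu]_(x in D) f x = \int[mu]_(x in D) g x.
Proof.
move=> [N [mN N0 fgN]].
have fg x : ~ N x -> (f \_ D) x = (g \_ D) x.
  move=> Nx; rewrite /patch; case: ifPn => //; rewrite inE => Dx.
  by apply: contrapT => fgx; apply: Nx; apply: fgN => /= /(_ Dx).
rewrite /integral /=; congr (_ - _); apply/eqP; rewrite eq_le.
  by rewrite !(nnint_le mN N0)// => x Nx; rewrite !funeposE fg.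
by rewrite !(nnint_le mN N0)// => x Nx; rewrite !funenegE fg.
Qed.

End ae_integral.

Section cousin.
Context {R : realType}.

(** The supremum [c] of the points of $[a,b]$ where [E] holds has such points at or just below it.
    The local hypothesis carries [E] from there to [b] if $c=b$, and otherwise to a point beyond
    [c], which is absurd. *)
Lemma real_induction (E : R -> Prop) (a b : R) : a <= b -> E a ->
  (forall c, a <= c <= b -> exists2 e : R, 0 < e &
     forall y z, a <= y -> y <= c -> c <= z -> z <= b -> c - e < y -> z < c + e ->
       E y -> E z) -> E b.
Proof.
move=> ab Ea step.
pose X := [set t | a <= t <= b /\ E t].
have Xa : X a by split; rewrite ?lexx.
have Xb : ubound X b by move=> t [/andP[]].
have supX : has_sup X by split; [exists a|exists b].
set c := sup X.
have ac : a <= c by apply: ub_le_sup => //; exists b.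
have cb : c <= b by apply: ge_sup => //; exists a.
have [|e e0 He] := step c; first by rewrite ac cb.
have [y [/andP[ay yb] Ey] cy] := sup_adherent e0 supX.
have yc : y <= c by apply: ub_le_sup; [exists b|split; rewrite ?ay].
have [bc|nbc] := eqVneq b c.
  by apply: (He y b) => //; rewrite bc// ltrDl.
have ltcb : c < b by rewrite lt_neqAle eq_sym nbc.
pose z := Num.min b (c + e / 2).
have cz : c < z by rewrite lt_min ltcb ltrDl divr_gt0.
have zc : z < c + e.
  by rewrite gt_min ltrD2l gtr_pMr// invf_lt1 ?ltr1n ?orbT.
have zb : z <= b by rewrite ge_min lexx.
have Ez : E z by apply: (He y z) => //; exact: ltW.
have : z <= c by apply: ub_le_sup; [exists b|split => //; rewrite zb (le_trans ac (ltW cz))].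
by rewrite leNgt cz.
Qed.

End cousin.

(** * Absolutely continuous functions *)

Section absolutely_continuous.
Context {R : realType}.
Notation mu := (@lebesgue_measure R).
Implicit Types (a b : R) (f : R -> R).

Let oo (p : R * R) : set R := `]p.1, p.2[%classic.

Let z0 : R * R := (0, 0).

(* Finite families of nonoverlapping intervals of [a, t] with interiors in [U],
   the rightmost one first. *)
Let chain a t (U : set R) (s : seq (R * R)) :=
  [/\ all (fun p => [&& a <= p.1, p.1 <= p.2 & p.2 <= t]) s,
      pairwise (fun p q => q.2 <= p.1) s &
      forall p, p \in s -> oo p `<=` U].

Let chain_disjoint a t U s : chain a t U s ->
  trivIset [set: nat] (fun i => oo (nth z0 s i)).
Proof.
move=> [_ /(pairwiseP z0) ps _].
have lt_disj i j x : (i < j)%N -> oo (nth z0 s i) x -> oo (nth z0 s j) x -> False.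
  (* Past the end of the list [nth] returns the default [z0], whose open interval is empty. *)
  rewrite /oo /= !in_itv/= => ij; have [js|js] := ltnP j (size s); last first.
    by rewrite [nth _ _ j]nth_default//= => _ /andP[/lt_trans h /h]; rewrite ltxx.
  have := ps i j; rewrite !inE => /(_ (ltn_trans ij js) js ij) h.
  by move=> /andP[xi _] /andP[_ xj]; have := lt_trans xi (lt_le_trans xj h); rewrite ltxx.
move=> i j _ _ [x [xi xj]]; have [ij|ij|//] := ltngtP i j.
- by have := lt_disj _ _ _ ij xi xj.
- by have := lt_disj _ _ _ ij xj xi.
Qed.

(** The intervals are disjoint with interiors in [U], so their total length is at most the measure
    of [U], hence below [d]. *)
Let chain_variation_lt a b U s f (e d : R) :
  open U -> chain a b U s -> (mu U < d%:E)%E ->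
  (forall (N : nat) (c : 'I_N -> R * R),
      (forall k, a <= (c k).1 /\ (c k).1 <= (c k).2 /\ (c k).2 <= b) ->
      trivIset [set: 'I_N] (fun k => oo (c k)) ->
      \sum_(k < N) ((c k).2 - (c k).1) < d ->
      \sum_(k < N) `|f (c k).2 - f (c k).1| < e) ->
  \sum_(p <- s) `|f p.2 - f p.1| < e.
Proof.
move=> oU chs mUd H; rewrite (big_nth z0) big_mkord.
have tr := chain_disjoint chs.
have [/allP als _ sU] := chs.
apply: (H (size s) (fun k => nth z0 s k)).
- by move=> k; have /als/and3P[] := mem_nth z0 (ltn_ord k).
- by move=> i j _ _ ij; apply/val_inj/tr.
rewrite -lte_fin; apply: le_lt_trans mUd.
have -> : (\sum_(k < size s) ((nth z0 s k).2 - (nth z0 s k).1))%:E =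
    (\sum_(k < size s) mu (oo (nth z0 s k)))%E.
  rewrite -sumEFin; apply: eq_bigr => k _; rewrite lebesgue_measure_itv/= lte_fin.
  have /als/and3P[_ + _] := mem_nth z0 (ltn_ord k).
  by rewrite le_eqVlt => /predU1P[->|->//]; rewrite ltxx subrr.
have mF i : measurable (oo (nth z0 s i)) by exact: measurable_itv.
rewrite -(measure_bigsetU mu mF tr) le_measure// ?inE//.
- rewrite -(bigcup_mkord _ (fun i => oo (nth z0 s i))).
  by apply: bigcup_measurable => k _; exact: mF.
- exact: open_measurable.
- rewrite -(bigcup_mkord _ (fun i => oo (nth z0 s i))).
  by move=> x [k ks]; apply: sU; exact: mem_nth.
Qed.

Lemma abs_continuous_ae_nincr f a b : a <= b -> abs_continuous a b f ->
  {ae mu, forall s : R, s \in `]a, b[ -> exists2 d, d <= 0 & is_derive s 1 f d} ->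
  f b <= f a.
Proof.
move=> ab acf [N [mN N0 Nf]].
(* An error [e] per unit length comes from the points outside [U], and a further [e] from the
   variation inside [U]. *)
suff H (e : R) : 0 < e -> f b - f a <= e * (b - a) + e.
  rewrite -subr_le0; apply/ler_addgt0Pl => e e0; rewrite addr0.
  have ba0 : 0 < b - a + 1 by rewrite ltr_wpDl ?subr_ge0.
  (* Dividing by $b-a+1$ makes the two errors add up to exactly [e]. *)
  have /H : 0 < e / (b - a + 1) by rewrite divr_gt0.
  set x := e / _ => Hx; rewrite (le_trans Hx)// -[X in _ + X]mulr1 -mulrDr divfK ?gt_eqF//.
move=> e0; have [d d0 Hd] := acf _ e0.
(* With the endpoints added, every point of $[a,b]$ outside [U] is interior and carries a
   nonpositive derivative. *)
pose N' := N `|` [set a; b].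
have m1 x : measurable [set x : R] by exact: measurable_set1.
have mab : measurable [set a; b] by apply: measurableU; exact: m1.
have mN' : measurable N' by apply: measurableU.
have ab0 : mu [set a; b] = 0.
  have := @null_set_setU _ _ _ (@lebesgue_measure R) _ _ (m1 a) (m1 b).
  apply; exact: lebesgue_measure_set1.
have N'0 : mu N' = 0 by exact: (null_set_setU mN mab N0 ab0).
have N'oo : (mu N' < +oo)%E by rewrite N'0.
have [U [oU N'U UN']] := lebesgue_regularity_outer mN' N'oo d0.
have Ud : (mu U < d%:E)%E.
  apply: le_lt_trans UN'.
  have mUN' : measurable (U `\` N').
    by apply: measurableD => //; exact: open_measurable.
  have {1}-> : U = (U `\` N') `|` N'.
    by apply/seteqP; split => [x Ux|x [[]|/N'U]//]; have [|] := pselect (N' x); [right|left].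
  by have /(_ mUN' mN' N'0)-> := @measureU0 _ _ _ mu (U `\` N') N'.
(* Claim to be propagated: the increment over $[a,t]$ is bounded by slope [e] plus the variation
   over some chain in [U]. *)
pose E t := exists2 s, chain a t U s &
  f t - f a <= e * (t - a) + \sum_(p <- s) `|f p.2 - f p.1|.
have [s chs fs] : E b; last first.
  by apply: (le_trans fs); rewrite lerD2l ltW// (chain_variation_lt oU chs Ud).
apply: (real_induction ab).
  by exists [::]; [split|rewrite big_nil !subrr mulr0 addr0].
move=> c /andP[ac cb].
have chW s y z : y <= z -> chain a y U s -> chain a z U s.
  move=> yz [s1 s2 s3]; split => //.
  apply: sub_all s1 => p /and3P[-> ->]/= py.
  exact: le_trans py yz.
(* Near a point of [U] the whole interval $[y,z]$ joins the chain, which pays for its increment. *)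
have [Uc|Uc] := pselect (U c).
  have /nbhs_ballP[r /= r0 rU] : nbhs c U by exact: open_nbhs_nbhs.
  exists r => // y z ay yc cz zb ycr zcr [s chs fs].
  have yz : y <= z by exact: le_trans cz.
  exists ((y, z) :: s).
    have [/allP s1 s2 s3] := chs; split => /=.
    - rewrite ay yz lexx/=; apply/allP => p /s1 /and3P[-> ->]/= py.
      exact: le_trans py yz.
    - rewrite s2 andbT; apply/allP => p /s1 /and3P[_ _].
      by [].
    - move=> p; rewrite inE => /predU1P[->|/s3//].
      apply: subset_trans rU => x; rewrite /oo/= in_itv/= => /andP[yx xz].
      by rewrite /ball/= ltr_distl; apply/andP; split; lra.
  rewrite big_cons/=.
  have := ler_norm (f z - f y).
  have : e * (y - a) <= e * (z - a) by rewrite ler_pM2l// lerD2r.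
  lra.
have Nc : ~ N c by move=> Nc; apply: Uc; apply: N'U; left.
have cab : c \in `]a, b[.
  rewrite in_itv/= !lt_neqAle ac cb !andbT; apply/andP; split; apply/eqP => h; apply: Uc;
    apply: N'U; right; [left|right]; rewrite /= h//.
have [/(_ cab)[D D0 [drf dfD]]|] :=
  pselect (c \in `]a, b[ -> exists2 d, d <= 0 & is_derive c 1 f d); last by move=> h; exfalso; apply: Nc; apply: Nf.
(* Off [U] the difference quotients at [c] are within [e] of $D\le0$. The increments over $[y,c]$
   and $[c,z]$ are thus at most [e] times the lengths, and the chain is unchanged. *)
have : h^-1 *: (f (h *: 1 + c) - f c) @[h --> 0^'] --> D by rewrite -dfD; exact: drf.
move=> /cvgrPdist_lt /(_ _ e0) [r /= r0 Hr].
exists r => // y z ay yc cz zb ycr zcr [s chs fs].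
exists s; first by apply: chW chs; exact: le_trans cz.
have hz : f z - f c <= e * (z - c).
  have [->|nzc] := eqVneq z c; first by rewrite !subrr mulr0.
  have zc0 : 0 < z - c by rewrite subr_gt0 lt_neqAle eq_sym nzc.
  have := Hr (z - c); rewrite /ball_/= sub0r normrN gtr0_norm// gt_eqF// => /(_ _ isT).
  rewrite ltrBlDl => /(_ zcr).
  rewrite [_%:A]mulr1 subrK ltr_distlC => /andP[_].
  rewrite -[_ *: _]/(_ * _) => h.
  have : (z - c)^-1 * (f z - f c) < e by lra.
  by rewrite mulrC ltr_pdivrMr// => /ltW; rewrite mulrC.
have hy : f c - f y <= e * (c - y).
  have [->|nzc] := eqVneq y c; first by rewrite !subrr mulr0.
  have zc0 : 0 < c - y by rewrite subr_gt0 lt_neqAle nzc.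
  have := Hr (y - c); rewrite /ball_/= sub0r normrN distrC gtr0_norm// subr_eq0 nzc.
  have -> : (c - y < r) = true by lra.
  move=> /(_ isT isT).
  rewrite [_%:A]mulr1 subrK ltr_distlC => /andP[_].
  rewrite -[_ *: _]/(_ * _) -(opprB c y) -(opprB (f c) (f y)) invrN mulrNN => h.
  have : (c - y)^-1 * (f c - f y) < e by lra.
  by rewrite mulrC ltr_pdivrMr// => /ltW; rewrite mulrC.
have -> : e * (z - a) = e * (z - c) + e * (c - y) + e * (y - a) by ring.
lra.
Qed.

End absolutely_continuous.

Section ae_lebesgue.
Context {R : realType}.
Notation mu := (@lebesgue_measure R).

Lemma ae_sub (P Q : R -> Prop) : (forall s, P s -> Q s) ->
  {ae mu, forall s, P s} -> {ae mu, forall s, Q s}.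
Proof. by apply: filterS; exact: (ae_filter_ringOfSetsType mu). Qed.

Lemma ae_sub2 (P Q S : R -> Prop) : (forall s, P s -> Q s -> S s) ->
  {ae mu, forall s, P s} -> {ae mu, forall s, Q s} -> {ae mu, forall s, S s}.
Proof. by apply: filterS2; exact: (ae_filter_ringOfSetsType mu). Qed.

Lemma ae_forall (I : finType) (P : I -> R -> Prop) :
  (forall i, {ae mu, forall s, P i s}) -> {ae mu, forall s, forall i, P i s}.
Proof.
move=> aeP; have := @filter_forall _ I P _ (ae_filter_ringOfSetsType mu) aeP.
by [].
Qed.

Lemma ae_neq (a : R) : {ae mu, forall s, s != a}.
Proof.
exists [set a]; split; first exact: measurable_set1.
  exact: lebesgue_measure_set1.
by move=> s /= /negP; rewrite negbK => /eqP.
Qed.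

End ae_lebesgue.

(** * Closure properties and the fundamental theorem of calculus *)

Section abs_continuous_theory.
Context {R : realType}.
Notation mu := (@lebesgue_measure R).
Implicit Types (a b : R).

(** Common source of the closure properties: sums, opposites, products and coordinates only need
    such a bound on increments. *)
Lemma abs_continuous_dominated (U V W : normedModType R) a b
    (f : R -> U) (g : R -> V) (h : R -> W) (K : R) :
  abs_continuous a b f -> abs_continuous a b g ->
  (forall c d, a <= c -> c <= d -> d <= b ->
     `|h d - h c| <= K * (`|f d - f c| + `|g d - g c|)) ->
  abs_continuous a b h.
Proof.
move=> acf acg hK e e0.
(* As [K] may be zero or negative, it is replaced by the positive $|K|+1$; [f] and [g] each receive
   half of the allowance. *)
pose e' := e / (`|K| + 1) / 2.
have K0 : 0 < `|K| + 1 by rewrite ltr_wpDl.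
have e'0 : 0 < e' by rewrite !divr_gt0.
have [d1 d10 H1] := acf _ e'0; have [d2 d20 H2] := acg _ e'0.
exists (Num.min d1 d2); first by rewrite lt_min d10.
move=> N c cab trc; rewrite lt_min => /andP[cd1 cd2].
have {}H1 := H1 _ _ cab trc cd1; have {}H2 := H2 _ _ cab trc cd2.
apply: (@le_lt_trans _ _ ((`|K| + 1) * (\sum_(k < N) `|f (c k).2 - f (c k).1| +
    \sum_(k < N) `|g (c k).2 - g (c k).1|))).
  rewrite -big_split/= mulr_sumr; apply: ler_sum => k _.
  have [ck [ck' ck'']] := cab k.
  apply: (le_trans (hK _ _ ck ck' ck'')); apply: ler_wpM2r; first by rewrite addr_ge0.
  by rewrite (le_trans (ler_norm _))// lerDl.
have -> : e = (`|K| + 1) * (e' + e').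
  by rewrite /e' -splitr mulrCA mulfV ?mulr1// gt_eqF.
by rewrite ltr_pM2l// ltrD.
Qed.

Lemma abs_continuousD (V : normedModType R) a b (f g : R -> V) :
  abs_continuous a b f -> abs_continuous a b g -> abs_continuous a b (f + g).
Proof.
move=> acf acg; apply: (abs_continuous_dominated (K := 1) acf acg) => c d _ _ _.
by rewrite mul1r !fctE opprD addrACA ler_normD.
Qed.

Lemma abs_continuousN (V : normedModType R) a b (f : R -> V) :
  abs_continuous a b f -> abs_continuous a b (- f).
Proof.
move=> acf; apply: (abs_continuous_dominated (K := 1) acf acf) => c d _ _ _.
by rewrite mul1r !fctE -opprD normrN lerDl.
Qed.

Lemma lipschitz_abs_continuous (V : normedModType R) a b (f : R -> V) (K : R) :
  (forall c d, a <= c -> c <= d -> d <= b -> `|f d - f c| <= K * (d - c)) ->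
  abs_continuous a b f.
Proof.
move=> fK e e0; have K0 : 0 < `|K| + 1 by rewrite ltr_wpDl.
exists (e / (`|K| + 1)); first by rewrite divr_gt0.
move=> N c cab _; rewrite ltr_pdivlMr// mulrC mulr_sumr; apply: le_lt_trans.
apply: ler_sum => k _; have [ck [ck' ck'']] := cab k.
apply: (le_trans (fK _ _ ck ck' ck'')); apply: ler_wpM2r; first by rewrite subr_ge0.
by rewrite (le_trans (ler_norm _))// lerDl.
Qed.

(** The integral of $|g|$ is small on every set of small measure; this is applied to the union of
    the disjoint intervals. *)
Lemma abs_continuous_Rintegral a (g : R -> R) b :
  mu.-integrable [set: R] (EFin \o g) ->
  abs_continuous a b (fun y => \int[mu]_(t in `[a, y]) g t).
Proof.
move=> ig e e0; have [d [d0 Hd]] := integral_normr_continuous ig e0.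
have igS D : measurable D -> mu.-integrable D (EFin \o g).
  by move=> mD; exact: integrableS ig.
exists d => // N c cab trc cd.
pose I k := `](c k).1, (c k).2[%classic.
have mI k : measurable (I k) by exact: measurable_itv.
have trI : trivIset [set` index_enum 'I_N] I by exact: sub_trivIset trc.
have uI : uniq (index_enum 'I_N) by exact: index_enum_uniq.
pose D := \big[setU/set0]_(k < N) I k.
have mD : measurable D by exact: bigsetU_measurable.
have muD : (mu D < d%:E)%E.
  rewrite -[mu D]mul1e -integral_cst// ge0_integral_bigsetU//.
  rewrite (eq_bigr (fun k => ((c k).2 - (c k).1)%:E)); first by rewrite sumEFin lte_fin.
  move=> k _; rewrite integral_cst; last exact: mI.
  rewrite mul1e -[LHS]/(mu (I k)) lebesgue_measure_itv/= lte_fin.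
  by have [_ []] := cab k; rewrite le_eqVlt => /predU1P[->|->//]; rewrite ltxx subrr.
apply: le_lt_trans (Hd _ mD muD).
rewrite /D /Rintegral ge0_integral_bigsetU//; last first.
  have /integrableP[/measurable_EFinP mg _] := igS _ mD.
  by apply/measurable_EFinP; exact: measurableT_comp.
have -> : (\sum_(k < N) \int[mu]_(x in I k) `|g x|%:E)%E =
    (\sum_(k < N) \int[mu]_(x in I k) `|g x|)%:E.
  rewrite -sumEFin; apply: eq_bigr => k _; rewrite fineK//.
  have := @integrable_fin_num _ _ _ mu (I k) (mI k) _ (integrable_norm (igS _ (mI k))).
  by [].
apply: ler_sum => k _; have [ck [ck' ck'']] := cab k.
rewrite Rintegral_itvB//; [|exact: igS].
rewrite -Rintegral_itv_bndo_bndc; last exact: igS.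
by apply: le_normr_Rintegral => //; exact: igS.
Qed.

(** By Lebesgue's differentiation theorem the indefinite integral [F] also has derivative [g] almost
    everywhere. So $f-F$ and $F-f$ have zero derivative almost everywhere, and neither can increase
    from [a] to [b]. *)
Lemma abs_continuous_FTC2 (f g : R -> R) a b : a <= b -> abs_continuous a b f ->
  {ae mu, forall s : R, s \in `]a, b[ -> is_derive s 1 f (g s)} ->
  mu.-integrable `[a, b] (EFin \o g) ->
  \int[mu]_(t in `[a, b]) g t = f b - f a.
Proof.
move=> ab acf fg ig.
(* Extension by zero makes the integrand integrable on the whole line. *)
pose g0 := g \_ `[a, b].
have ig0 : mu.-integrable [set: R] (EFin \o g0).
  rewrite /g0 -restrict_EFin; exact: ((integrable_mkcond (mu := mu) _ (measurable_itv _)).1 ig).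
pose F y := \int[mu]_(t in `[a, y]) g0 t.
have acF : abs_continuous a b F by exact: abs_continuous_Rintegral.
have dF : {ae mu, forall s : R, s \in `]a, b[ -> is_derive s 1 F (g s)}.
  have iy y : mu.-integrable `[a, y] (EFin \o g0) by exact: integrableS ig0.
  have lg0 : locally_integrable setT g0 by exact: integrable_locally.
  have := FTC1 iy lg0; apply: ae_sub => s + /[!in_itv]/= /andP[sa sb].
  rewrite lte_fin => /(_ sa)[dFs FsE].
  apply: DeriveDef => //; rewrite -derive1E FsE /g0 patchE mem_set//=.
  by rewrite in_itv/= !ltW.
have Fb : F b = \int[mu]_(t in `[a, b]) g t.
  by apply: eq_Rintegral => x xab; rewrite /g0 patchE xab.
have Fa : F a = 0.
  by rewrite /F set_itv1 Rintegral_set1.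
have mono (h k : R -> R) : abs_continuous a b h -> abs_continuous a b k ->
    {ae mu, forall s : R, s \in `]a, b[ -> is_derive s 1 h (g s)} ->
    {ae mu, forall s : R, s \in `]a, b[ -> is_derive s 1 k (g s)} ->
    h b - k b <= h a - k a.
  move=> ach ack dh dk; apply: (@abs_continuous_ae_nincr _ (h - k)) => //.
    by apply: abs_continuousD => //; exact: abs_continuousN.
  apply: ae_sub2 dh dk => s hs ks sab; exists 0 => //; rewrite -(subrr (g s)).
  by apply: is_deriveB; [exact: hs|exact: ks].
have := mono _ _ acf acF fg dF; have := mono _ _ acF acf dF fg.
by rewrite -Fb Fa; lra.
Qed.

End abs_continuous_theory.

(** * Clamping to an interval, and bounds on compact intervals *)

Section clamp.
Context {R : realType}.
Implicit Types (a b s t : R).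

(** Projection onto $[a,b]$ when $a\le b$. Composing with it extends a function continuous on
    $[a,b]$ to one continuous on the whole line. *)
Definition clamp a b t := Num.max a (Num.min t b).

Lemma clamp_itv a b t : a <= b -> clamp a b t \in `[a, b].
Proof. by move=> ab; rewrite in_itv/= le_max lexx/= ge_max ab ge_min lexx orbT. Qed.

Lemma clamp_id a b t : t \in `[a, b] -> clamp a b t = t.
Proof. by rewrite in_itv/= => /andP[at_ tb]; rewrite /clamp min_l// max_r. Qed.

Lemma clamp_lipschitz a b s t : `|clamp a b s - clamp a b t| <= `|s - t|.
Proof.
wlog st : s t / s <= t.
  by move=> h; have [/h//|/ltW/h] := leP s t; rewrite distrC (distrC t).
rewrite distrC (distrC s) (ger0_norm (x := t - s)) ?subr_ge0// ler_norml /clamp.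
by case: (leP s b); case: (leP t b); case: (leP a s); case: (leP a t); case: (leP a b); lra.
Qed.

Lemma clamp_continuous a b : continuous (clamp a b).
Proof.
move=> t; apply/cvgrPdist_lt => e e0; apply/nbhs_ballP; exists e => // s.
by rewrite /ball/=; exact: le_lt_trans (clamp_lipschitz _ _ _ _).
Qed.

Lemma within_continuous_clamp (V : topologicalType) a b (f : R -> V) : a <= b ->
  {within `[a, b], continuous f} -> continuous (f \o clamp a b).
Proof.
move=> ab /subspace_continuousP cf t A nA.
have /nbhs_ballP[e /= e0 He] := cf _ (clamp_itv t ab) _ nA.
apply/nbhs_ballP; exists e => // s ts; apply: He; last exact: clamp_itv.
by rewrite /ball/= (le_lt_trans (clamp_lipschitz _ _ _ _)).
Qed.

Lemma abs_continuous_clamp (V : normedModType R) a b (f : R -> V) : a <= b ->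
  abs_continuous a b f -> continuous (f \o clamp a b).
Proof.
move=> ab acf t; apply/cvgrPdist_lt => e e0.
have [d d0 Hd] := acf _ e0.
have le2 c c' : a <= c -> c <= c' -> c' <= b -> c' - c < d -> `|f c' - f c| < e.
  move=> ac cc' c'b cd; have := Hd 1%N (fun=> (c, c')).
  rewrite !big_ord1/=; apply => //.
  by move=> i j _ _ _; rewrite !ord1.
apply/nbhs_ballP; exists d => // s /=; rewrite /ball/= => ts.
have := le_lt_trans (clamp_lipschitz a b t s) ts.
have /andP[]: a <= clamp a b t <= b by have := clamp_itv t ab.
have /andP[]: a <= clamp a b s <= b by have := clamp_itv s ab.
have [st|/ltW ts'] := leP (clamp a b s) (clamp a b t) => h1 h2 h3 h4.
  by rewrite ger0_norm ?subr_ge0//; exact: le2.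
by rewrite distrC ger0_norm ?subr_ge0// distrC; exact: le2.
Qed.

Lemma continuous_bounded_itv (f : R -> R) a b : continuous f ->
  exists2 K, 0 <= K & forall t, t \in `[a, b] -> `|f t| <= K.
Proof.
move=> cf; have [ab|ba] := leP a b; last first.
  by exists 0 => // t; rewrite in_itv/= => /andP[/le_trans h /h]; rewrite leNgt ba.
have [|c _ H] := @EVT_max _ (fun t => `|f t|) a b ab; last by exists `|f c|.
by apply: continuous_subspaceT => t; apply: cvg_norm; exact: cf.
Qed.

Lemma bounded_derive_lipschitz (f df : R -> R) a b (K : R) :
  {within `[a, b], continuous f} ->
  (forall s : R, s \in `]a, b[ -> is_derive s 1 f (df s) /\ `|df s| <= K) ->
  forall c d, a <= c -> c <= d -> d <= b -> `|f d - f c| <= K * (d - c).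
Proof.
move=> cf dfK c d ac; rewrite le_eqVlt => /predU1P[->|cd] db.
  by rewrite !subrr normr0 mulr0.
have sub s : s \in `]c, d[ -> s \in `]a, b[.
  by rewrite !in_itv/= => /andP[cs sd]; apply/andP; split; lra.
have dcd s : s \in `]c, d[ -> is_derive s 1 f (df s) by move=> /sub/dfK[].
have ccd : {within `[c, d], continuous f}.
  apply: continuous_subspaceW cf => s /=; rewrite !in_itv/= => /andP[cs sd].
  by apply/andP; split; lra.
have [s scd ->] := MVT cd dcd ccd.
have dc0 : 0 <= d - c by rewrite subr_ge0 ltW.
by rewrite normrM (ger0_norm dc0) ler_wpM2r//; have [] := dfK _ (sub _ scd).
Qed.

End clamp.

(** * Calculus of almost everywhere derivatives *)

Section ac_deriv.
Context {R : realType}.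
Notation mu := (@lebesgue_measure R).
Variables (a b : R).
Hypothesis ab : a <= b.
Implicit Types (f g : R -> R).

(** The fundamental theorem needs both properties, and both pass to sums and products, so they
    travel together. *)
Definition ac_deriv f f' := abs_continuous a b f /\
  {ae mu, forall s : R, s \in `]a, b[ -> is_derive s 1 f (f' s)}.

Lemma ac_deriv_cst (c : R) : ac_deriv (fun=> c) (fun=> 0).
Proof.
split; last by apply: aeW => s _; exact: is_derive_cst.
by apply: (@lipschitz_abs_continuous _ _ _ _ _ 0) => *; rewrite subrr normr0 mul0r.
Qed.

Lemma ac_derivD f g f' g' : ac_deriv f f' -> ac_deriv g g' ->
  ac_deriv (fun t => f t + g t) (fun t => f' t + g' t).
Proof.
move=> [cf df] [cg dg]; split; first exact: abs_continuousD.
by apply: ae_sub2 df dg => s hf hg sab; apply: is_deriveD; [exact: hf|exact: hg].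
Qed.

Lemma ac_derivM f g f' g' : ac_deriv f f' -> ac_deriv g g' ->
  ac_deriv (fun t => f t * g t) (fun t => f' t * g t + f t * g' t).
Proof.
move=> [cf df] [cg dg]; split; last first.
  apply: ae_sub2 df dg => s hf hg sab.
  have h := @is_deriveM _ _ f g s 1 _ _ (hf sab) (hg sab).
  by apply: (is_derive_eq h); rewrite -![_ *: _]/(_ * _); ring.
(* Both factors are bounded on $[a,b]$, so the increment of the product is dominated by those of the
   factors. *)
have [Kf Kf0 fK] := continuous_bounded_itv a b (abs_continuous_clamp ab cf).
have [Kg Kg0 gK] := continuous_bounded_itv a b (abs_continuous_clamp ab cg).
apply: (abs_continuous_dominated (K := Kf + Kg) cf cg) => c d ac cd db.
have cab : c \in `[a, b] by rewrite in_itv/= ac (le_trans cd).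
have dab : d \in `[a, b] by rewrite in_itv/= db (le_trans ac).
have := fK _ dab; rewrite /= clamp_id// => fd.
have := gK _ cab; rewrite /= clamp_id// => gc.
have -> : f d * g d - f c * g c = f d * (g d - g c) + g c * (f d - f c) by ring.
rewrite (le_trans (ler_normD _ _))// !normrM.
have := normr_ge0 (f d - f c); have := normr_ge0 (g d - g c); nra.
Qed.

Lemma ac_deriv_sum (I : Type) (s : seq I) (f f' : I -> R -> R) :
  (forall i, ac_deriv (f i) (f' i)) ->
  ac_deriv (fun t => \sum_(i <- s) f i t) (fun t => \sum_(i <- s) f' i t).
Proof.
move=> H; elim: s => [|i s IH].
  under eq_fun do rewrite big_nil; under [X in ac_deriv _ X]eq_fun do rewrite big_nil.
  exact: ac_deriv_cst.
under eq_fun do rewrite big_cons; under [X in ac_deriv _ X]eq_fun do rewrite big_cons.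
exact: ac_derivD.
Qed.

Lemma ac_deriv_ae f f' g' : ac_deriv f f' ->
  {ae mu, forall s : R, s \in `]a, b[ -> f' s = g' s} -> ac_deriv f g'.
Proof.
move=> [cf df] fg; split => //; apply: ae_sub2 df fg => s hf hfg sab.
by rewrite -hfg//; exact: hf.
Qed.

Definition ac_derivmx p q (M M' : R -> 'M[R]_(p, q)) :=
  forall i j, ac_deriv (fun t => M t i j) (fun t => M' t i j).

Lemma ac_derivmxD p q (M N M' N' : R -> 'M[R]_(p, q)) :
  ac_derivmx M M' -> ac_derivmx N N' ->
  ac_derivmx (fun t => M t + N t) (fun t => M' t + N' t).
Proof.
move=> hM hN i j; have := ac_derivD (hM i j) (hN i j).
by congr ac_deriv; apply/funext => t; rewrite !mxE.
Qed.

Lemma ac_derivmxM p q r (M M' : R -> 'M[R]_(p, q)) (N N' : R -> 'M[R]_(q, r)) :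
  ac_derivmx M M' -> ac_derivmx N N' ->
  ac_derivmx (fun t => M t *m N t) (fun t => M' t *m N t + M t *m N' t).
Proof.
move=> hM hN i j.
have := ac_deriv_sum (index_enum 'I_q) (fun k => ac_derivM (hM i k) (hN k j)).
congr ac_deriv; apply/funext => t; rewrite !mxE//.
by rewrite -big_split; apply: eq_bigr => k _.
Qed.

Lemma ac_derivmx_tr p q (M M' : R -> 'M[R]_(p, q)) :
  ac_derivmx M M' -> ac_derivmx (fun t => (M t)^T) (fun t => (M' t)^T).
Proof.
move=> hM i j; have := hM j i.
by congr ac_deriv; apply/funext => t; rewrite !mxE.
Qed.

End ac_deriv.

Section matrix_valued.
Context {R : realType} {p q : nat}.
Implicit Types (M : R -> 'M[R]_(p, q)).

Lemma norm_coord_le (M : 'M[R]_(p, q)) i j : `|M i j| <= `|M|.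
Proof. by rewrite [leRHS]/Num.Def.normr/= mx_normrE; exact: (le_bigmax _ _ (i, j)). Qed.

Lemma norm_le_coord (M : 'M[R]_(p, q)) (K : R) : 0 <= K ->
  (forall i j, `|M i j| <= K) -> `|M| <= K.
Proof.
move=> K0 MK; rewrite [leLHS]/Num.Def.normr/= mx_normrE.
by apply: bigmax_le => // -[i j] _; exact: MK.
Qed.

Lemma abs_continuous_coord a b M i j :
  abs_continuous a b M -> abs_continuous a b (fun t => M t i j).
Proof.
move=> acM; apply: (abs_continuous_dominated (K := 1) acM acM) => c d _ _ _.
have -> : M d i j - M c i j = (M d - M c) i j by rewrite !mxE.
by rewrite mul1r (le_trans (norm_coord_le _ _ _))// lerDl.
Qed.

Lemma is_derive_coord M (t : R) (M' : 'M[R]_(p, q)) i j :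
  is_derive t 1 M M' -> is_derive t 1 (fun t => M t i j) (M' i j).
Proof.
move=> [dM M'E]; apply: DeriveDef; first exact: (derivable_mxP _ _ _).1.
by rewrite -M'E derive_mx// mxE.
Qed.

Lemma is_derive_mx M (t : R) (M' : 'M[R]_(p, q)) :
  (forall i j, is_derive t 1 (fun t => M t i j) (M' i j)) -> is_derive t 1 M M'.
Proof.
move=> dM; have dM0 : derivable M t 1 by apply/derivable_mxP => i j; have [] := dM i j.
apply: DeriveDef => //; rewrite derive_mx//; apply/matrixP => i j; rewrite mxE.
by have [_ ->] := dM i j.
Qed.

Lemma ac_derivmx_of a b M (M' : R -> 'M[R]_(p, q)) : abs_continuous a b M ->
  {ae (@lebesgue_measure R), forall s : R, s \in `]a, b[ -> is_derive s 1 M (M' s)} ->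
  ac_derivmx a b M M'.
Proof.
move=> acM dM i j; split; first exact: abs_continuous_coord.
by apply: ae_sub dM => s h /h; exact: is_derive_coord.
Qed.

End matrix_valued.

(** * Continuous and square integrable matrix functions *)

Section continuous_matrix.
Context {R : realType}.

(** Continuity is global: coefficients given only on an interval enter after composition with
    [clamp]. *)
Definition contmx p q (M : R -> 'M[R]_(p, q)) :=
  forall i j, continuous (fun t => M t i j).

Lemma contmx_of p q (M : R -> 'M[R]_(p, q)) : continuous M -> contmx M.
Proof.
move=> cM i j t.
apply: (@continuous_comp _ _ _ M (fun N : 'M[R]_(p, q) => N i j)); first exact: cM.
exact: coord_continuous.
Qed.

Lemma continuous_bigsum (I : Type) (s : seq I) (P : pred I) (f : I -> R -> R) :
  (forall i, continuous (f i)) -> continuous (fun t => \sum_(i <- s | P i) f i t).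
Proof.
move=> cf; elim: s => [|i s IH].
  by under eq_fun do rewrite big_nil; exact: cst_continuous.
under eq_fun do rewrite big_cons; case: (P i) => // t.
by apply: cvgD; [exact: cf|exact: IH].
Qed.

Lemma continuous_bigprod (I : Type) (s : seq I) (P : pred I) (f : I -> R -> R) :
  (forall i, continuous (f i)) -> continuous (fun t => \prod_(i <- s | P i) f i t).
Proof.
move=> cf; elim: s => [|i s IH].
  by under eq_fun do rewrite big_nil; exact: cst_continuous.
under eq_fun do rewrite big_cons; case: (P i) => // t.
by apply: cvgM; [exact: cf|exact: IH].
Qed.

Lemma contmxD p q (M N : R -> 'M[R]_(p, q)) :
  contmx M -> contmx N -> contmx (fun t => M t + N t).
Proof.
move=> cM cN i j; under eq_fun do rewrite mxE.
by move=> t; apply: cvgD; [exact: cM|exact: cN].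
Qed.

Lemma contmxN p q (M : R -> 'M[R]_(p, q)) : contmx M -> contmx (fun t => - M t).
Proof.
by move=> cM i j; under eq_fun do rewrite mxE; move=> t; apply: cvgN; exact: cM.
Qed.

Lemma contmxM p q r (M : R -> 'M[R]_(p, q)) (N : R -> 'M[R]_(q, r)) :
  contmx M -> contmx N -> contmx (fun t => M t *m N t).
Proof.
move=> cM cN i j; under eq_fun do rewrite mxE.
by apply: continuous_bigsum => k t; apply: cvgM; [exact: cM|exact: cN].
Qed.

Lemma contmx_tr p q (M : R -> 'M[R]_(p, q)) : contmx M -> contmx (fun t => (M t)^T).
Proof. by move=> cM i j; under eq_fun do rewrite mxE; exact: cM. Qed.

Lemma continuous_det p (M : R -> 'M[R]_p) : contmx M -> continuous (fun t => \det (M t)).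
Proof.
move=> cM; rewrite /determinant; apply: continuous_bigsum => s t.
apply: cvgM; first exact: cvg_cst.
by apply: continuous_bigprod => i; exact: cM.
Qed.

(** By Cramer's rule the entries of the inverse are cofactors divided by a determinant that never
    vanishes. *)
Lemma contmx_inv p (M : R -> 'M[R]_p) : contmx M -> (forall t, M t \in unitmx) ->
  contmx (fun t => invmx (M t)).
Proof.
move=> cM uM i j; rewrite /invmx; under eq_fun do rewrite uM mxE mxE /cofactor.
move=> t; apply: cvgM.
  apply: cvgV; last exact: continuous_det.
  by have := uM t; rewrite unitmxE unitfE.
apply: cvgM; first exact: cvg_cst.
apply: continuous_det => k k'; under eq_fun do rewrite !mxE; exact: cM.
Qed.

Lemma contmx_bounded p q (M : R -> 'M[R]_(p, q)) (a b : R) : contmx M ->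
  exists2 K, 0 <= K & forall t i j, t \in `[a, b] -> `|M t i j| <= K.
Proof.
move=> cM; pose K i j := sval (cid2 (continuous_bounded_itv a b (cM i j))).
have K0 i j : 0 <= K i j by rewrite /K; case: cid2.
have MK i j t : t \in `[a, b] -> `|M t i j| <= K i j.
  by rewrite /K; case: cid2 => ? ? /= h; exact: h.
exists (\sum_i \sum_j K i j); first by do 2!apply: sumr_ge0 => ? _.
move=> t i j tab; apply: (le_trans (MK _ _ _ tab)).
rewrite (bigD1 i)//= (bigD1 j)//= -addrA lerDl addr_ge0//; first exact: sumr_ge0.
by do 2!apply: sumr_ge0 => ? _.
Qed.

End continuous_matrix.

(** * Square integrable functions and integrability of quadratic forms *)

Section square_integrable.
Context {R : realType}.
Notation mu := (@lebesgue_measure R).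
Variables (a b : R).
Implicit Types (f g h : R -> R).

(** Unlike [L2], this asks for a function that is itself Borel, as integrability statements
    require. *)
Definition sqint f := measurable_fun [set: R] f /\
  mu.-integrable `[a, b] (EFin \o (fun t => f t ^+ 2)).

Let mab : measurable (`[a, b] : set R).
Proof. exact: measurable_itv. Qed.

Lemma continuous_integrable_itv f : continuous f -> mu.-integrable `[a, b] (EFin \o f).
Proof.
move=> cf; apply: measurable_bounded_integrable => //.
- have : (mu `[a, b] < +oo)%E by rewrite lebesgue_measure_itv/=; case: ifP => //; rewrite ltry.
  by [].
- by apply: measurable_funTS; exact: continuous_measurable_fun.
- have [K K0 fK] := continuous_bounded_itv a b cf.
  exists K; split; first exact: num_real.
  by move=> x Kx t tab; apply: le_trans (fK _ tab) _; exact: ltW.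
Qed.

(** Domination by a sum of squares covers products, squares of sums and multiples by continuous
    functions. *)
Lemma sqint_dominated f g h K : measurable_fun [set: R] h -> sqint f -> sqint g ->
  (forall t, t \in `[a, b] -> `|h t| <= K * (f t ^+ 2 + g t ^+ 2)) ->
  mu.-integrable `[a, b] (EFin \o h).
Proof.
move=> mh [mf if2] [mg ig2] hK.
have ifg : mu.-integrable `[a, b] (EFin \o (fun t => K * (f t ^+ 2 + g t ^+ 2))).
  by apply: (integrableZl _ K (integrableD _ if2 ig2)).
apply: (le_integrable _ _ _ ifg) => //.
  by apply/measurable_EFinP; exact: measurable_funTS.
move=> t tab /=; rewrite lee_fin (le_trans (hK _ tab))//; exact: ler_norm.
Qed.

Lemma continuous_sqint f : continuous f -> sqint f.
Proof.
move=> cf; split; first exact: continuous_measurable_fun.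
by apply: continuous_integrable_itv => t; apply: cvgM; exact: cf.
Qed.

Lemma sqint_mul_integrable f g : sqint f -> sqint g ->
  mu.-integrable `[a, b] (EFin \o (fun t => f t * g t)).
Proof.
move=> hf hg; have [mf _] := hf; have [mg _] := hg.
apply: (@sqint_dominated f g _ 1) => //; first exact: measurable_funM.
move=> t _; rewrite mul1r normrM -(real_normK (num_real (f t))) -(real_normK (num_real (g t))).
by have := normr_ge0 (f t); have := normr_ge0 (g t); nra.
Qed.

Lemma sqintD f g : sqint f -> sqint g -> sqint (fun t => f t + g t).
Proof.
move=> hf hg; have [mf _] := hf; have [mg _] := hg.
have mfg := measurable_funD mf mg; split => //.
apply: (@sqint_dominated f g _ 2) => //; first exact: measurable_funX.
by move=> t _ /=; rewrite ger0_norm ?sqr_ge0//; have := sqr_ge0 (f t - g t); lra.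
Qed.

Lemma sqint_cmul f g : continuous f -> sqint g -> sqint (fun t => f t * g t).
Proof.
move=> cf hg; have [mg _] := hg.
have mf : measurable_fun [set: R] f by exact: continuous_measurable_fun.
have mfg := measurable_funM mf mg; split => //.
have [K K0 fK] := continuous_bounded_itv a b cf.
apply: (@sqint_dominated g g _ (K ^+ 2)) => //; first exact: measurable_funX.
move=> t tab; rewrite ger0_norm ?sqr_ge0// exprMn.
have : f t ^+ 2 <= K ^+ 2.
  by rewrite -(real_normK (num_real (f t))) lerXn2r ?nnegrE ?fK.
by have := sqr_ge0 (g t); have := sqr_ge0 K; nra.
Qed.

Lemma sqint_sum (I : Type) (s : seq I) (f : I -> R -> R) :
  (forall i, sqint (f i)) -> sqint (fun t => \sum_(i <- s) f i t).
Proof.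
move=> cf; elim: s => [|i s IH].
  under eq_fun do rewrite big_nil.
  by apply: continuous_sqint; exact: cst_continuous.
by under eq_fun do rewrite big_cons; exact: sqintD.
Qed.

Definition sqintmx p q (M : R -> 'M[R]_(p, q)) := forall i j, sqint (fun t => M t i j).

Lemma sqintmxD p q (M N : R -> 'M[R]_(p, q)) :
  sqintmx M -> sqintmx N -> sqintmx (fun t => M t + N t).
Proof. by move=> hM hN i j; under eq_fun do rewrite mxE; exact: sqintD. Qed.

Lemma sqintmxM p q r (M : R -> 'M[R]_(p, q)) (N : R -> 'M[R]_(q, r)) :
  contmx M -> sqintmx N -> sqintmx (fun t => M t *m N t).
Proof.
move=> cM hN i j; under eq_fun do rewrite mxE.
by apply: sqint_sum => k; exact: sqint_cmul.
Qed.

Lemma contmx_sqintmx p q (M : R -> 'M[R]_(p, q)) : contmx M -> sqintmx M.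
Proof. by move=> cM i j; exact: continuous_sqint. Qed.

Lemma bform_integrable p q (x : R -> 'cV[R]_p) (M : R -> 'M[R]_(p, q)) (u : R -> 'cV[R]_q) :
  sqintmx x -> contmx M -> sqintmx u ->
  mu.-integrable `[a, b] (EFin \o (fun t => bform (x t) (M t) (u t))).
Proof.
move=> hx cM hu; have hMu := sqintmxM cM hu.
have := @integrable_sum _ _ _ mu _ mab _ (index_enum 'I_p) xpredT _
  (fun k _ => sqint_mul_integrable (hx k 0) (hMu k 0)).
congr (mu.-integrable _ _); apply/funext => t /=.
rewrite sumEFin /bform -mulmxA mxE; congr EFin.
by apply: eq_bigr => k _; rewrite [in RHS]mxE.
Qed.

(** Passage from a control to a Borel representative, on which the integral calculus is carried
    out. *)
Lemma L2_sqintmx p (u : R -> 'cV[R]_p) : L2 a b u ->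
  exists2 v, sqintmx v & {ae mu, forall t : R, t \in `[a, b] -> u t = v t}.
Proof.
move=> /= L2u; pose g j := sval (cid2 (L2u j)).
have gL j : g j \in Lfun mu 2%:E by rewrite /g; case: cid2.
have ug j : {ae mu, forall t : R, t \in `]a, b[ -> u t j 0 = g j t}.
  by rewrite /g; case: cid2.
exists (fun t => \col_j g j t).
  move=> i j; under eq_fun do rewrite mxE; split.
    by have := gL i; rewrite inE => /andP[]; rewrite inE.
  by have := Lfun2_integrable_sqr (gL i); exact: integrableS.
(* [L2] speaks of the open interval; the two endpoints form a null set. *)
have ab' : {ae mu, forall t : R, t != a /\ t != b}.
  exact: ae_sub2 (fun t ta tb => conj ta tb) (ae_neq a) (ae_neq b).
apply: ae_sub2 (ae_forall ug) ab' => t ht [ta tb] tab; apply/colP => j; rewrite mxE.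
apply: ht; move: tab; rewrite !in_itv/= !lt_neqAle => /andP[-> ->].
by rewrite eq_sym ta tb.
Qed.

(** The witness is [v] set to zero outside $[a,b]$, so that it is square integrable over the whole
    line. *)
Lemma continuous_L2 p (u v : R -> 'cV[R]_p) : contmx v ->
  (forall t, t \in `[a, b] -> u t = v t) -> L2 a b u.
Proof.
move=> cv uv j; pose g := (fun t => v t j 0) \_ `[a, b].
have mg : measurable_fun [set: R] g.
  apply/(measurable_restrictT _ _).1 => //; apply: measurable_funTS.
  exact: continuous_measurable_fun.
exists g; last first.
  apply: aeW => t tab; rewrite /g patchE.
  have tab' : t \in `[a, b] by move: tab; rewrite !in_itv/= => /andP[/ltW-> /ltW->].
  by rewrite uv// mem_set.
rewrite inE; apply/andP; split; rewrite inE//= /finite_norm unlock poweR_lty//.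
have [_ ig] := contmx_sqintmx cv j 0.
pose w t := v t j 0 ^+ 2.
have -> : (\int[mu]_x (`|(EFin \o g) x| `^ 2) = \int[mu]_(x in `[a, b]) (EFin \o w) x)%E.
  rewrite [RHS]integral_mkcond; apply: eq_integral => t _.
  rewrite /= /g /w !patchE; case: ifP => _ /=.
    by rewrite powR_mulrn// real_normK// num_real.
  by rewrite normr0 powR0.
by have := @integrable_lty _ _ _ mu _ mab _ ig.
Qed.

End square_integrable.

(** * Linear differential equations *)

Section linear_ode.
Context {R : realType}.
Notation mu := (@lebesgue_measure R).

Lemma continuous_antiderivative (h : R -> R) (a : R) : continuous h ->
  exists2 H : R -> R, H a = 0 & forall t, a <= t -> is_derive t 1 H (h t).
Proof.
(* Integration starts at $a-1$, so that the two-sided derivative exists at [a] as well. *)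
move=> ch; pose F y := \int[mu]_(t in `[a - 1, y]) h t.
have dF t : a <= t -> is_derive t 1 F (h t).
  move=> at_; have t1 : t < t + 1 by rewrite ltrDl.
  have ih := continuous_integrable_itv (a - 1) (t + 1) ch.
  have at1 : a - 1 < t by lra.
  have [dFt FtE] := continuous_FTC1_closed t1 ih at1 (ch t).
  by apply: DeriveDef => //; rewrite -derive1E.
exists (fun y => F y - F a); first by rewrite subrr.
move=> t /dF dFt; have h0 := is_deriveB dFt (is_derive_cst (F a) t 1).
by apply: (is_derive_eq h0); rewrite subr0.
Qed.

(** The exponential majorant is nonnegative at [a], where [H] vanishes, and its derivative is the
    bound on [h]. The mean value theorem compares it with [H] and with $-H$. *)
Lemma derive_expRM_bound (H h : R -> R) (a b K la : R) : H a = 0 -> 0 <= K ->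
  (forall t, a <= t -> is_derive t 1 H (h t)) ->
  (forall t, t \in `[a, b] -> `|h t| <= K * la * expR (la * (t - a))) ->
  forall t, t \in `[a, b] -> `|H t| <= K * expR (la * (t - a)).
Proof.
move=> Ha K0 dH hK.
have dE (t : R) : is_derive t 1 (fun s => K * expR (la * (s - a))) (K * la * expR (la * (t - a))).
  have h1 : is_derive t 1 (fun s : R => la * (s - a)) la.
    have h0 := is_deriveZ la (is_deriveB (is_derive_id t 1) (is_derive_cst a t 1)).
    by apply: (is_derive_eq h0); rewrite subr0 /GRing.scale/= mulr1.
  have h2 := is_deriveZ K
    (@is_derive1_comp _ expR (fun s => la * (s - a)) t _ _ (is_derive_expR _) h1).
  by apply: (is_derive_eq h2); rewrite /GRing.scale/=; ring.
have one_sided (G g : R -> R) : G a = 0 -> (forall t, a <= t -> is_derive t 1 G (g t)) ->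
    (forall t, t \in `[a, b] -> g t <= K * la * expR (la * (t - a))) ->
    forall t, t \in `[a, b] -> G t <= K * expR (la * (t - a)).
  move=> Ga dG gK t; rewrite in_itv/= => /andP[]; rewrite le_eqVlt => /predU1P[<-|at_] tb.
    by rewrite Ga subrr mulr0 expR0 mulr1.
  have dD s : s \in `]a, t[ -> is_derive s 1 (G - (fun s => K * expR (la * (s - a))))
      (g s - K * la * expR (la * (s - a))).
    by rewrite in_itv/= => /andP[/ltW as_ _]; apply: is_deriveB; exact: dG.
  have cD : {within `[a, t], continuous (G - (fun s => K * expR (la * (s - a))))}.
    apply: derivable_within_continuous => s; rewrite in_itv/= => /andP[as_ _].
    by have [] : is_derive s 1 (G - (fun s => K * expR (la * (s - a))))
      (g s - K * la * expR (la * (s - a))) by apply: is_deriveB; exact: dG.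
  have [s sat /eqP] := MVT at_ dD cD.
  rewrite !fctE Ga subrr mulr0 expR0 mulr1 => /eqP DE.
  have : (g s - K * la * expR (la * (s - a))) * (t - a) <= 0.
    rewrite mulr_le0_ge0 ?subr_ge0 ?(ltW at_)// subr_le0; apply: gK.
    by move: sat; rewrite !in_itv/= => /andP[as_ st]; apply/andP; split; lra.
  by lra.
move=> t tab; rewrite ler_norml; apply/andP; split.
  rewrite lerNl; apply: (one_sided (- H) (- h)) => //.
  - by rewrite fctE Ha oppr0.
  - by move=> s /dH ?; exact: is_deriveN.
  - by move=> s /hK; rewrite ler_norml => /andP[+ _]; rewrite lerNl.
by apply: (one_sided H h) => // s /hK; rewrite ler_norml => /andP[].
Qed.

Lemma geometric_cauchy_limit (u : nat -> R) (K : R) :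
  (forall k, `|u k.+1 - u k| <= K * 2^-1 ^+ k) ->
  exists x, forall k, `|x - u k| <= 2 * K * 2^-1 ^+ k.
Proof.
(* [e k] is the tail from [k] of the geometric series, so the intervals of radius [e k] about [u k]
   are nested; the supremum of their left endpoints is the limit. *)
move=> uK; pose e k := 2 * K * 2^-1 ^+ k : R.
have eS k : e k.+1 = e k - K * 2^-1 ^+ k by rewrite /e exprS; field.
have K0 k : 0 <= K * 2^-1 ^+ k by apply: le_trans (uK k).
have e0 k : 0 <= e k by rewrite /e -mulrA mulr_ge0.
have lo k m : u k - e k <= u (k + m)%N - e (k + m)%N.
  elim: m => [|m IH]; first by rewrite addn0.
  rewrite addnS; apply: (le_trans IH).
  by have := uK (k + m)%N; rewrite eS ler_norml => /andP[]; lra.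
have hi k m : u (k + m)%N + e (k + m)%N <= u k + e k.
  elim: m => [|m IH]; first by rewrite addn0.
  rewrite addnS; apply: le_trans IH.
  by have := uK (k + m)%N; rewrite eS ler_norml => /andP[]; lra.
have lohi k m : u k - e k <= u m + e m.
  have := lo k m; have := hi m k; rewrite addnC; have := e0 (k + m)%N; lra.
pose X := [set u k - e k | k in [set: nat]].
have ubX k : ubound X (u k + e k) by move=> _ [m _ <-].
exists (sup X) => k; rewrite ler_distl; apply/andP; split.
  by apply: ub_le_sup; [exists (u 0%N + e 0%N)|exists k].
by apply: ge_sup => //; exists (u 0%N - e 0%N); exists 0%N.
Qed.

Lemma geometric_lt (C e : R) : 0 < e -> exists k, C * 2^-1 ^+ k < e.
Proof.
move=> e0; have C0 : 0 < `|C| + 1 by rewrite ltr_wpDl.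
have : 2^-1 ^+ k @[k --> \oo] --> (0 : R).
  by apply: cvg_expr; rewrite ger0_norm// invf_lt1// ltr1n.
move=> /cvgrPdist_lt /(_ (e / (`|C| + 1))) [|k _ /(_ k (leqnn k))].
  by rewrite !divr_gt0.
rewrite /= sub0r normrN ger0_norm ?exprn_ge0// ltr_pdivlMr// => H; exists k.
apply: le_lt_trans H; rewrite mulrC ler_wpM2l ?exprn_ge0//.
by rewrite (le_trans (ler_norm _))// lerDl.
Qed.

Lemma le_geometric_eq0 (y C : R) : (forall k, `|y| <= C * 2^-1 ^+ k) -> y = 0.
Proof.
move=> yC; apply/eqP; rewrite -normr_le0; apply/ler_addgt0Pl => e e0; rewrite addr0.
by have [k /ltW kC] := geometric_lt C e0; exact: le_trans (yC k) kC.
Qed.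

Lemma geometric_limit_continuous (u : nat -> R -> R) (x : R -> R) (C : R) :
  (forall k, continuous (u k)) ->
  (forall k t, `|x t - u k t| <= C * 2^-1 ^+ k) -> continuous x.
Proof.
move=> cu xu t; apply/cvgrPdist_lt => e e0.
have e30 : 0 < e / 3 by rewrite divr_gt0.
have [k kC] := geometric_lt C e30.
have := cu k t; move=> /cvgrPdist_lt /(_ _ e30); apply: filterS => s uts.
have := le_lt_trans (xu k t) kC; have := le_lt_trans (xu k s) kC.
move: uts; rewrite !ltr_norml => /andP[? ?] /andP[? ?] /andP[? ?].
by apply/andP; split; lra.
Qed.

End linear_ode.

(** * Picard iteration *)

Section picard.
Context {R : realType} {n : nat}.
Variables (a b : R) (M : R -> 'M[R]_n) (c : R -> 'cV[R]_n) (x0 : 'cV[R]_n).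
Hypotheses (ab : a <= b) (cM : contmx M) (cc : contmx c).

(* [y] is an antiderivative of [M x + c] starting from [x0]; agreement is only
   asked on [a, b], so that iterates may be frozen outside this interval. *)
Let picard (x y : R -> 'cV[R]_n) (H : 'I_n -> R -> R) := forall i,
  [/\ H i a = 0,
      forall t : R, a <= t -> is_derive t 1 (H i) ((M t *m x t + c t) i 0) &
      forall t, t \in `[a, b] -> y t i 0 = x0 i 0 + H i t].

Let picard_ex x : contmx x -> exists y, contmx y /\ exists H, picard x y H.
Proof.
move=> cx; have ch i : continuous (fun t => (M t *m x t + c t) i 0).
  exact: (contmxD (contmxM cM cx) cc).
pose H i := sval (cid2 (continuous_antiderivative a (ch i))).
have Ha i : H i a = 0 by rewrite /H; case: cid2.
have dH i t : a <= t -> is_derive t 1 (H i) ((M t *m x t + c t) i 0).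
  by rewrite /H; case: cid2 => ? /= ? h; exact: h.
exists (fun t => \col_i (x0 i 0 + H i (clamp a b t))); split.
  move=> i j; under eq_fun do rewrite mxE.
  move=> t; apply: cvgD; first exact: cvg_cst.
  apply: (within_continuous_clamp ab).
  apply: derivable_within_continuous => s; rewrite in_itv/= => /andP[as_ _].
  by have [] := dH i s as_.
exists H => i; split; [exact: Ha|exact: dH|by move=> t tab; rewrite mxE clamp_id].
Qed.

Let dist_le (la K : R) (x x' : R -> 'cV[R]_n) :=
  forall t i, t \in `[a, b] -> `|x t i 0 - x' t i 0| <= K * expR (la * (t - a)).

(* The weight [expR (la * (t - a))] turns the Picard map into a contraction. *)
Let picard_contraction : exists2 la, 0 <= la & forall x x' y y' H H' K, 0 <= K ->
  picard x y H -> picard x' y' H' -> dist_le la K x x' -> dist_le la (K / 2) y y'.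
Proof.
have [L L0 ML] := contmx_bounded a b cM.
(* [L] bounds the entries of [M], so each of the [n] terms of a row contributes at most [L] times
   the distance; the factor 2 gives the contraction ratio one half. *)
exists (2 * (n%:R * L)); first by rewrite mulr_ge0// mulr_ge0.
set la := 2 * _; move=> x x' y y' H H' K K0 pH pH' xx' t i tab.
have [Ha dH yH] := pH i; have [Ha' dH' yH'] := pH' i.
rewrite yH// yH'// opprD addrACA subrr add0r.
have dHH' s : a <= s -> is_derive s 1 (H i - H' i) ((M s *m (x s - x' s)) i 0).
  move=> as_; have h := is_deriveB (dH _ as_) (dH' _ as_).
  apply: (is_derive_eq h).
  by rewrite mulmxBr !mxE; ring.
apply: (derive_expRM_bound (H := H i - H' i) _ _ dHH' _ tab).
- by rewrite !fctE Ha Ha' subrr.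
- by rewrite divr_ge0.
move=> s sab; rewrite mxE (le_trans (ler_norm_sum _ _ _))//.
have -> : K / 2 * la * expR (la * (s - a)) =
    \sum_(k < n) (L * (K * expR (la * (s - a)))).
  by rewrite sumr_const card_ord -mulr_natl /la; field.
apply: ler_sum => k _; rewrite normrM !mxE ler_pM//; first exact: ML.
exact: xx'.
Qed.

(** The iterates started from the constant [x0] converge geometrically, uniformly on $[a,b]$; the
    limit is continuous and is a fixed point of the Picard map. *)
Lemma linear_ode : exists x : R -> 'cV[R]_n, [/\ abs_continuous a b x, x a = x0 &
  forall t, a <= t -> t <= b -> is_derive t 1 x (M t *m x t + c t)].
Proof.
have [la la0 contr] := picard_contraction.
(* Continuity is carried in the type, so that every iterate has a Picard image. *)
pose step (x : {x : R -> 'cV[R]_n | contmx x}) : {x : R -> 'cV[R]_n | contmx x} :=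
  let h := cid (picard_ex (svalP x)) in exist _ (sval h) (svalP h).1.
have stepP x : exists H, picard (sval x) (sval (step x)) H.
  by rewrite /step /=; case: cid => ? [].
have c0 : contmx (fun=> x0) by move=> i j; exact: cst_continuous.
pose u k := sval (iter k step (exist _ _ c0)).
have cu k : contmx (u k) by exact: svalP.
have uP k : exists H, picard (u k) (u k.+1) H by exact: stepP.
have E1 t : t \in `[a, b] -> 1 <= expR (la * (t - a)).
  rewrite in_itv/= => /andP[at_ _].
  by rewrite -expR0 ler_expR mulr_ge0// subr_ge0.
have E2 t : t \in `[a, b] -> expR (la * (t - a)) <= expR (la * (b - a)).
  by rewrite in_itv/= => /andP[_ tb]; rewrite ler_expR ler_wpM2l// lerD2r.
have [K K0 uK] : exists2 K, 0 <= K & forall k, dist_le la (K * 2^-1 ^+ k) (u k.+1) (u k).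
  have [K K0 uK] := contmx_bounded a b (contmxD (cu 1%N) (contmxN (cu 0%N))).
  exists K => // k.
  elim: k => [t i tab|k IH].
    have := uK t i 0 tab; rewrite !mxE expr0 mulr1 => /le_trans; apply.
    by rewrite ler_peMr// E1.
  have [H pH] := uP k; have [H' pH'] := uP k.+1.
  rewrite exprSr mulrA.
  by apply: (contr _ _ _ _ _ _ _ _ pH' pH IH); rewrite mulr_ge0// exprn_ge0.
(* The largest value of the weight is absorbed into the constant, which gives an unweighted uniform
   bound. *)
pose K' := K * expR (la * (b - a)).
have uK' t i k : `|u k.+1 (clamp a b t) i 0 - u k (clamp a b t) i 0| <= K' * 2^-1 ^+ k.
  have tab := clamp_itv t ab; apply: (le_trans (uK k _ i tab)).
  by rewrite /K' mulrAC ler_wpM2r ?exprn_ge0// ler_wpM2l// E2.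
pose x t := \col_i sval (cid (geometric_cauchy_limit (uK' t i))).
have xu t i k : `|x t i 0 - u k (clamp a b t) i 0| <= 2 * K' * 2^-1 ^+ k.
  by rewrite mxE; case: cid => ? /= h; exact: h.
have cx : contmx x.
  move=> i j; rewrite ord1.
  apply: (@geometric_limit_continuous _ (fun k t => u k (clamp a b t) i 0)
    (fun t => x t i 0) (2 * K')) => [k|k t]; last exact: xu.
  move=> t; apply: (@continuous_comp _ _ _ (clamp a b) (fun s => u k s i 0)).
    exact: clamp_continuous.
  exact: cu.
have [y [_ [H pH]]] := picard_ex cx.
(* By the contraction, [x] and its Picard image [y] are both within a multiple of $2^{-k}$ of the
   iterate of rank $k+1$. *)
have xy t i : t \in `[a, b] -> x t i 0 = y t i 0.
  move=> tab; apply/eqP; rewrite -subr_eq0; apply/eqP.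
  apply: (@le_geometric_eq0 _ _ (2 * K' * expR (la * (b - a)) + 2 * K')) => k.
  have [Hk pHk] := uP k.
  have xuk : dist_le la (2 * K' * 2^-1 ^+ k) (u k) x.
    move=> s j sab; have := xu s j k; rewrite clamp_id// distrC => /le_trans; apply.
    rewrite ler_peMr ?E1// mulr_ge0 ?exprn_ge0// mulr_ge0//.
    by rewrite /K' mulr_ge0 ?expR_ge0.
  have C0 : 0 <= 2 * K' * 2^-1 ^+ k.
    by rewrite mulr_ge0 ?exprn_ge0// mulr_ge0// /K' mulr_ge0 ?expR_ge0.
  have := contr _ _ _ _ _ _ _ C0 pHk pH xuk t i tab.
  have := xu t i k.+1; rewrite clamp_id//.
  have -> : x t i 0 - y t i 0 =
    (x t i 0 - u k.+1 t i 0) + (u k.+1 t i 0 - y t i 0) by ring.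
  move=> h1 h2; apply: (le_trans (ler_normD _ _)).
  move: h1 h2; rewrite exprS; set w := _ ^+ k; set E := expR _; set Eb := expR _.
  have w0 : 0 <= w by exact: exprn_ge0.
  have K'w : 0 <= K' * w by rewrite mulr_ge0// /K' mulr_ge0 ?expR_ge0.
  have EEb : E <= Eb by exact: E2.
  have Eb0 : 0 <= Eb by exact: expR_ge0.
  have := ler_wpM2l K'w EEb; have := mulr_ge0 K'w Eb0; lra.
(* Without freezing outside $[a,b]$, the solution has two-sided derivatives at the endpoints too. *)
pose z t := \col_i (x0 i 0 + H i t).
have zx t : t \in `[a, b] -> z t = x t.
  move=> tab; apply/colP => i; rewrite mxE xy//.
  by have [_ _ ->] := pH i.
have dz t i : a <= t -> is_derive t 1 (fun t => z t i 0) ((M t *m x t + c t) i 0).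
  move=> at_; have [_ dH _] := pH i.
  have h := is_deriveD (is_derive_cst (x0 i 0) t 1) (dH _ at_).
  have -> : (fun t => z t i 0) = cst (x0 i 0) + H i.
    by apply/funext => s; rewrite mxE.
  by apply: (is_derive_eq h); rewrite add0r.
exists z; split.
- have [L L0 xL] := contmx_bounded a b (contmxD (contmxM cM cx) cc).
  apply: (@lipschitz_abs_continuous _ _ _ _ _ L) => s t as_ st tb.
  apply: norm_le_coord => [|i j]; first by rewrite mulr_ge0// subr_ge0.
  rewrite ord1 mxE [(- z s) i 0]mxE.
  apply: (@bounded_derive_lipschitz _ (fun t => z t i 0)
    (fun t => (M t *m x t + c t) i 0) a b) => //.
    apply: derivable_within_continuous => r; rewrite in_itv/= => /andP[ar _].
    by have [] := dz r i ar.
  move=> r; rewrite in_itv/= => /andP[ar rb]; split; first by apply: dz; exact: ltW.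
  by apply: xL; rewrite in_itv/= !ltW.
- apply/colP => i; rewrite mxE; have [-> _ _] := pH i.
  by rewrite addr0.
- move=> t at_ tb; have tab : t \in `[a, b] by rewrite in_itv/= at_.
  apply: is_derive_mx => i j; rewrite ord1 zx//; exact: dz.
Qed.

End picard.

(** * The linear-quadratic problem *)

Section bilinear_forms.
Context {R : realType}.

Lemma dotvC n (x y : 'cV[R]_n) : dotv x y = dotv y x.
Proof. by rewrite /dotv !mxE; apply: eq_bigr => k _; rewrite !mxE mulrC. Qed.

Lemma dotvDl n (x y z : 'cV[R]_n) : dotv (x + y) z = dotv x z + dotv y z.
Proof. by rewrite /dotv linearD/= mulmxDl mxE. Qed.

Lemma dotvDr n (x y z : 'cV[R]_n) : dotv z (x + y) = dotv z x + dotv z y.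
Proof. by rewrite /dotv mulmxDr mxE. Qed.

Lemma dotvNr n (x z : 'cV[R]_n) : dotv z (- x) = - dotv z x.
Proof. by rewrite /dotv mulmxN mxE. Qed.

Lemma dotv_mulmx n l (x : 'cV[R]_n) (M : 'M[R]_(n, l)) (u : 'cV[R]_l) :
  dotv x (M *m u) = dotv (M^T *m x) u.
Proof. by rewrite /dotv trmx_mul trmxK mulmxA. Qed.

Lemma bformE n l (x : 'cV[R]_n) (M : 'M[R]_(n, l)) (u : 'cV[R]_l) :
  bform x M u = dotv x (M *m u).
Proof. by rewrite /bform /dotv mulmxA. Qed.

Lemma dotv_ge_sqr n (x : 'cV[R]_n) i : x i 0 ^+ 2 <= dotv x x.
Proof.
rewrite /dotv mxE (bigD1 i)//= mxE -expr2 lerDl.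
by apply: sumr_ge0 => k _; rewrite mxE -expr2 sqr_ge0.
Qed.

Lemma posdefmx_unit n (M : 'M[R]_n) : posdefmx M -> M \in unitmx.
Proof.
move=> [Msym Mpos]; rewrite -row_free_unit -kermx_eq0; apply/negPn/negP.
move=> /rowV0Pn[v /sub_kermxP vM v0].
have : 0 < bform v^T M v^T.
  apply: Mpos; apply: contra_neq v0 => v0.
  by rewrite -(trmxK v) v0 trmx0.
by rewrite /bform trmxK vM mul0mx mxE ltxx.
Qed.

(** Each term is at most $\frac K2(x_i^2+x_j^2)$; these bounds sum to the right-hand side. *)
Lemma bform_bounded n (M : 'M[R]_n) (K : R) (x : 'cV[R]_n) : 0 <= K ->
  (forall i j, `|M i j| <= K) -> bform x M x <= n%:R * K * dotv x x.
Proof.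
move=> K0 MK; have dotE : dotv x x = \sum_i x i 0 ^+ 2.
  by rewrite /dotv mxE; apply: eq_bigr => i _; rewrite mxE.
have -> : n%:R * K * dotv x x = \sum_i \sum_j (K / 2 * (x i 0 ^+ 2 + x j 0 ^+ 2)).
  under eq_bigr do rewrite -mulr_sumr big_split/= sumr_const card_ord -dotE.
  rewrite -mulr_sumr big_split/= sumrMnl sumr_const card_ord -dotE.
  by rewrite -(mulr_natl (dotv x x)); field.
rewrite bformE /dotv mxE; apply: ler_sum => i _.
rewrite !mxE mulr_sumr; apply: ler_sum => j _.
have := MK i j; rewrite ler_norml => /andP[].
have := sqr_ge0 (x i 0 - x j 0); have := sqr_ge0 (x i 0 + x j 0).
nra.
Qed.

(** * Completion of squares *)

Section completion_of_squares.
Variables (n l : nat) (A P Q : 'M[R]_n) (B S : 'M[R]_(n, l)) (Rm : 'M[R]_l).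
Variables (x q : 'cV[R]_n) (u : 'cV[R]_l).
Hypotheses (Psym : P^T = P) (Rpos : posdefmx Rm).

Let K := invmx Rm.
Let Cpp0 := B *m K *m B^T.
Let Cxx0 := Q - S *m K *m S^T.
Let Cxp0 := A - B *m K *m S^T.
Let P' := P^T *m Cpp0 *m P - P^T *m Cxp0 - Cxp0^T *m P - Cxx0.
Let q' := P^T *m Cpp0 *m q - Cxp0^T *m q.
Let x' := A *m x + B *m u.
Let uk := - (K *m (B^T *m P *m x + B^T *m q + S^T *m x)).

(** The left side is the time derivative of $\frac12x^TPx+q^Tx+r$ along $x'=Ax+Bu$, with the Riccati
    right-hand sides in place of the derivatives of [P], [q] and [r]. *)
Lemma hamilton_jacobi_square :
  2^-1 * (bform x' P x + bform x P' x + bform x P x') +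
    (dotv q' x + dotv q x') + 2^-1 * bform q Cpp0 q =
  2^-1 * bform (u - uk) Rm (u - uk) -
    (2^-1 * bform x Q x + 2^-1 * bform u Rm u + bform x S u).
Proof.
have [Rsym _] := Rpos; have Runit := posdefmx_unit Rpos.
have Ksym : K^T = K by rewrite /K trmx_inv Rsym.
have RK (y : 'cV[R]_l) : Rm *m (K *m y) = y by rewrite mulKVmx.
have KC (y z : 'cV[R]_l) : dotv z (K *m y) = dotv y (K *m z).
  by rewrite dotv_mulmx Ksym dotvC.
have RC (y z : 'cV[R]_l) : dotv z (Rm *m y) = dotv y (Rm *m z).
  by rewrite dotv_mulmx Rsym dotvC.
(* All terms reduce to scalar products of these three vectors, of [u] and of [A *m x]; the feedback
   is $-K(y_1+y_2+y_3)$. *)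
pose y1 := B^T *m (P *m x); pose y2 := B^T *m q; pose y3 := S^T *m x.
have Pt (y z : 'cV[R]_n) : dotv y (P *m z) = dotv (P *m y) z by rewrite dotv_mulmx Psym.
have e1 : bform x P' x = dotv y1 (K *m y1) - 2 * (dotv (P *m x) (A *m x) - dotv y1 (K *m y3))
    - (dotv x (Q *m x) - dotv y3 (K *m y3)).
  rewrite bformE /P' /Cpp0 /Cxp0 /Cxx0 Psym [(A - _)^T]linearB /= !trmx_mul !trmxK Ksym.
  rewrite !(mulmxBl, mulmxBr) -!mulmxA !(dotvDr, dotvNr).
  rewrite !(Pt x) (dotv_mulmx (P *m x) B) (dotv_mulmx x S) (dotv_mulmx x A^T) trmxK.
  rewrite (dotv_mulmx (P *m x) B) (dotv_mulmx x S).
  rewrite -/y1 -/y3 (KC y1 y3) (dotvC (A *m x)); ring.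
have e2 : dotv q' x = dotv y2 (K *m y1) - (dotv q (A *m x) - dotv y2 (K *m y3)).
  rewrite dotvC /q' /Cpp0 /Cxp0 Psym [(A - _)^T]linearB /= !trmx_mul !trmxK Ksym.
  rewrite !(mulmxBl, mulmxBr) -!mulmxA !(dotvDr, dotvNr).
  rewrite (Pt x) (dotv_mulmx (P *m x) B) (dotv_mulmx x S) (dotv_mulmx x A^T) trmxK.
  rewrite -/y1 -/y2 -/y3 (KC y2 y1) (KC y2 y3) (dotvC (A *m x)); ring.
have e3 : bform q Cpp0 q = dotv y2 (K *m y2).
  by rewrite bformE /Cpp0 -!mulmxA dotv_mulmx.
have e4 : bform x P x' = dotv (P *m x) (A *m x) + dotv y1 u.
  by rewrite bformE Pt /x' dotvDr (dotv_mulmx _ B).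
have e5 : bform x' P x = dotv (P *m x) (A *m x) + dotv y1 u.
  by rewrite bformE dotvC /x' dotvDr (dotv_mulmx _ B).
have e6 : dotv q x' = dotv q (A *m x) + dotv y2 u.
  by rewrite /x' dotvDr (dotv_mulmx _ B).
have e7 : bform x S u = dotv y3 u by rewrite bformE dotv_mulmx.
have e8 : bform (u - uk) Rm (u - uk) = dotv u (Rm *m u) +
    2 * (dotv y1 u + dotv y2 u + dotv y3 u) + dotv y1 (K *m y1) + dotv y2 (K *m y2) +
    dotv y3 (K *m y3) + 2 * (dotv y2 (K *m y1) + dotv y1 (K *m y3) + dotv y2 (K *m y3)).
  rewrite bformE /uk opprK -!mulmxA -/y1 -/y2 -/y3 !mulmxDr !RK.
  rewrite !(dotvDl, dotvDr) !(dotvC u).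
  rewrite !(RC u) !RK !(dotvC (K *m _)) (KC y1 y2) (KC y1 y3) (KC y2 y3).
  rewrite (dotvC u y1) (dotvC u y2) (dotvC u y3); ring.
rewrite e1 e2 e3 e4 e5 e6 e7 e8 !bformE; lra.
Qed.

End completion_of_squares.
End bilinear_forms.

Section smooth_ac_deriv.
Context {R : realType}.
Notation mu := (@lebesgue_measure R).

Lemma abs_continuousS (V : normedModType R) (a b a' b' : R) (f : R -> V) :
  a <= a' -> b' <= b -> abs_continuous a b f -> abs_continuous a' b' f.
Proof.
move=> aa' bb' acf e e0; have [d d0 Hd] := acf _ e0; exists d => // N c cab.
apply: Hd => k; have [ck [ck' ck'']] := cab k.
by split; [exact: le_trans ck|split => //; exact: le_trans bb'].
Qed.

Lemma ac_derivS (a b a' b' : R) (f f' : R -> R) :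
  a <= a' -> b' <= b -> ac_deriv a b f f' -> ac_deriv a' b' f f'.
Proof.
move=> aa' bb' [acf df]; split; first exact: abs_continuousS acf.
apply: ae_sub df => s + sab; apply; move: sab; rewrite !in_itv/= => /andP[as_ sb].
by apply/andP; split; lra.
Qed.

(** The derivative extends continuously to the closed interval, hence is bounded, and [f] is
    Lipschitz. *)
Lemma ac_deriv_smooth (a b : R) (f f' : R -> R) : a <= b ->
  {within `[a, b], continuous f} ->
  (forall t : R, t \in `]a, b[ -> is_derive t 1 f (f' t)) ->
  continuous (f' \o clamp a b) -> ac_deriv a b f f'.
Proof.
move=> ab cf df cf'; split; last by apply: aeW.
have [K K0 f'K] := continuous_bounded_itv a b cf'.
apply: (@lipschitz_abs_continuous _ _ _ _ _ K).
apply: (bounded_derive_lipschitz (df := f') cf) => s sab; split; first exact: df.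
have sab' : s \in `[a, b] by move: sab; rewrite !in_itv/= => /andP[/ltW-> /ltW->].
by have := f'K _ sab'; rewrite /= clamp_id.
Qed.

Lemma ac_derivmx_smooth (a b : R) p q (M M' : R -> 'M[R]_(p, q)) : a <= b ->
  {within `[a, b], continuous M} ->
  (forall t : R, t \in `]a, b[ -> is_derive t 1 M (M' t)) ->
  contmx (M' \o clamp a b) -> ac_derivmx a b M M'.
Proof.
move=> ab cM dM cM' i j; apply: ac_deriv_smooth => //; last exact: cM'.
  move=> t; apply: (@continuous_comp (subspace `[a, b]) _ _ M (fun N : 'M[R]_(p, q) => N i j)).
    exact: cM.
  exact: coord_continuous.
by move=> t /dM; exact: is_derive_coord.
Qed.

Lemma ac_deriv_expR (a b la : R) : a <= b ->
  ac_deriv a b (fun t => expR (la * t)) (fun t => la * expR (la * t)).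
Proof.
move=> ab; have dE (t : R) : is_derive t 1 (fun s => expR (la * s)) (la * expR (la * t)).
  have h1 : is_derive t 1 (fun s : R => la * s) la.
    by apply: (is_derive_eq (is_deriveZ la (is_derive_id t 1))); rewrite /GRing.scale/= mulr1.
  have h2 := @is_derive1_comp _ expR (fun s => la * s) t _ _ (is_derive_expR _) h1.
  by apply: (is_derive_eq h2); rewrite mulrC.
have cE : continuous (fun s : R => expR (la * s)).
  move=> t; apply: differentiable_continuous; apply/derivable1_diffP.
  by have [] := dE t.
apply: ac_deriv_smooth => //; first exact: continuous_subspaceT.
move=> t; apply: cvgM; first exact: cvg_cst.
apply: (@continuous_comp _ _ _ (clamp a b) (fun s => expR (la * s))).
  exact: clamp_continuous.
exact: cE.
Qed.

End smooth_ac_deriv.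

(** * Trajectories and value functions *)

Section linear_quadratic.
Context {R : realType} (n l : nat).
Notation mu := (@lebesgue_measure R).
Variables (T : R) (A : R -> 'M[R]_n) (B S : R -> 'M[R]_(n, l))
  (Q : R -> 'M[R]_n) (Rm : R -> 'M[R]_l).
Hypotheses (T0 : 0 <= T) (hA : cont_into T setT A) (hB : cont_into T setT B)
  (hS : cont_into T setT S) (hQ : cont_into T (@posdefmx R n) Q)
  (hR : cont_into T (@posdefmx R l) Rm).
Variables (t0 : R) (ht0 : t0 \in `[0, T]).

(** Composed with [cl], the coefficients are continuous on the whole line and [Rm] is positive
    definite, hence invertible, at all times. *)
Let cl := clamp 0 T.

Let t00 : 0 <= t0. Proof. by move: ht0; rewrite in_itv/= => /andP[]. Qed.
Let t0T : t0 <= T. Proof. by move: ht0; rewrite in_itv/= => /andP[]. Qed.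

Let clE t : t \in `[t0, T] -> cl t = t.
Proof.
rewrite in_itv/= => /andP[t0t tT]; rewrite /cl clamp_id// in_itv/= tT andbT.
exact: le_trans t0t.
Qed.

Let cont_cl p q (E : set 'M[R]_(p, q)) (M : R -> 'M[R]_(p, q)) :
  cont_into T E M -> contmx (fun t => M (cl t)).
Proof. by move=> [cM _]; apply: contmx_of; exact: within_continuous_clamp. Qed.

Let Rpos t : posdefmx (Rm (cl t)).
Proof. by have [_] := hR; apply; exact: clamp_itv. Qed.

Let cA : contmx (fun t => A (cl t)) := cont_cl hA.
Let cB : contmx (fun t => B (cl t)) := cont_cl hB.
Let cS : contmx (fun t => S (cl t)) := cont_cl hS.
Let cQ : contmx (fun t => Q (cl t)) := cont_cl hQ.
Let cR : contmx (fun t => Rm (cl t)) := cont_cl hR.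
Let cRV : contmx (fun t => invmx (Rm (cl t))).
Proof. by apply: contmx_inv => // t; exact: posdefmx_unit. Qed.
Let cCpp : contmx (fun t => Cpp B Rm (cl t)).
Proof. by apply: contmxM; [exact: contmxM|exact: contmx_tr]. Qed.
Let cCxx : contmx (fun t => Cxx S Q Rm (cl t)).
Proof.
apply: contmxD => //; apply: contmxN.
by apply: contmxM; [exact: contmxM|exact: contmx_tr].
Qed.
Let cCxp : contmx (fun t => Cxp A B S Rm (cl t)).
Proof.
apply: contmxD => //; apply: contmxN.
by apply: contmxM; [exact: contmxM|exact: contmx_tr].
Qed.

Let continuous_bform p q (x : R -> 'cV[R]_p) (M : R -> 'M[R]_(p, q)) (u : R -> 'cV[R]_q) :
  contmx x -> contmx M -> contmx u -> continuous (fun t => bform (x t) (M t) (u t)).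
Proof. by move=> cx cM cu; exact: (contmxM (contmxM (contmx_tr cx) cM) cu). Qed.

Let traj_ac x0 x u : trajectory A B T t0 x0 x u ->
  ac_derivmx t0 T x (fun s => A s *m x s + B s *m u s).
Proof. by move=> [acx dx _]; exact: ac_derivmx_of. Qed.

Let traj_cont x0 x u : trajectory A B T t0 x0 x u -> contmx (fun t => x (clamp t0 T t)).
Proof. by move=> [acx _ _]; apply: contmx_of; exact: abs_continuous_clamp. Qed.

Lemma trajectory_L2 x0 x u : trajectory A B T t0 x0 x u -> L2 t0 T x.
Proof.
by move=> tr; apply: (continuous_L2 (traj_cont tr)) => t t0T'; rewrite clamp_id.
Qed.

(** Gronwall's argument: the difference solves $d'=Ad$, so $e^{-Ct}|d|^2$ is nonincreasing for
    $C=2nK$, with [K] a bound on the entries of [A], and it vanishes at [t0]. *)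
Lemma trajectory_unique x0 x y u :
  trajectory A B T t0 x0 x u -> trajectory A B T t0 x0 y u ->
  forall t, t \in `[t0, T] -> x t = y t.
Proof.
move=> trx try t; rewrite in_itv/= => /andP[t0t tT].
have [_ _ xt0] := trx; have [_ _ yt0] := try.
pose d t := x t - y t.
have dd : ac_derivmx t0 T d (fun s => A s *m d s).
  (* The opposite of [y] is treated as a product with the constant scalar matrix $-1$. *)
  have hN : ac_derivmx t0 T (fun s => (-1)%:M *m y s)
      (fun s => 0 *m y s + (-1)%:M *m (A s *m y s + B s *m u s)).
    apply: (ac_derivmxM t0T _ (traj_ac try)) => i j.
    have := @ac_deriv_cst R t0 T ((-1)%:M i j : R).
    by congr ac_deriv; apply/funext => s; rewrite mxE.
  have := ac_derivmxD (traj_ac trx) hN.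
  congr ac_derivmx; apply/funext => s; first by rewrite /d mul_scalar_mx scaleN1r.
  rewrite mul0mx add0r mul_scalar_mx scaleN1r mulmxBr opprD addrACA.
  by rewrite subrr addr0.
have [K K0 AK] := contmx_bounded t0 T cA.
pose phi s := dotv (d s) (d s).
pose C := 2 * (n%:R * K).
have dphi : ac_deriv t0 T phi (fun s => 2 * bform (d s) (A s) (d s)).
  have := ac_derivmxM t0T (ac_derivmx_tr dd) dd.
  move=> /(_ 0 0); congr ac_deriv; apply/funext => s.
  rewrite [LHS]mxE -/(dotv _ _) -/(dotv _ _) bformE (dotvC (A s *m _)); ring.
have dg := ac_derivM t0T (ac_deriv_expR (- C) t0T) dphi.
have [acg dg'] := ac_derivS (lexx t0) tT dg.
have : expR (- C * t) * phi t <= expR (- C * t0) * phi t0.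
  apply: (abs_continuous_ae_nincr t0t acg).
  apply: ae_sub dg' => s h /[dup] sab /h; eexists; last by eassumption.
  have sab' : s \in `[t0, T].
    by move: sab; rewrite !in_itv/= => /andP[/ltW-> /ltW/le_trans->].
  have AsK i j : `|A s i j| <= K by have := AK s i j sab'; rewrite clE.
  have := @bform_bounded _ _ (A s) K (d s) K0 AsK.
  rewrite -/(phi s) => h1; have e0 := expR_ge0 (- C * s).
  have -> : - C * expR (- C * s) * phi s + expR (- C * s) * (2 * bform (d s) (A s) (d s)) =
    2 * expR (- C * s) * (bform (d s) (A s) (d s) - n%:R * K * phi s) by rewrite /C; ring.
  by rewrite mulr_ge0_le0 ?mulr_ge0// subr_le0.
have -> : phi t0 = 0.
  by rewrite /phi /d xt0 yt0 subrr /dotv mulmx0 mxE.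
rewrite mulr0 pmulr_rle0 ?expR_gt0// => phit.
apply/eqP; rewrite -subr_eq0; apply/eqP/colP => i.
rewrite [RHS]mxE; apply/eqP; rewrite -sqrf_eq0; apply/eqP/le_anti.
by rewrite sqr_ge0 andbT (le_trans (dotv_ge_sqr _ _)).
Qed.


Section value_function.
Variables (G : 'M[R]_n) (a : 'cV[R]_n) (b : R)
  (P : R -> 'M[R]_n) (q : R -> 'cV[R]_n) (r : R -> R).
Hypothesis hPqr : riccati_solution A B S Q Rm T G a b P q r.

Let dP t := (P t)^T *m Cpp B Rm t *m P t - (P t)^T *m Cxp A B S Rm t
  - (Cxp A B S Rm t)^T *m P t - Cxx S Q Rm t.
Let dq t := (P t)^T *m Cpp B Rm t *m q t - (Cxp A B S Rm t)^T *m q t.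
Let dr t := 2^-1 * bform (q t) (Cpp B Rm t) (q t).

Let cP : contmx (fun t => P (cl t)).
Proof. by have [[hP _ _] _ _ _ _] := hPqr; exact: cont_cl hP. Qed.

Let cq : contmx (fun t => q (cl t)).
Proof. by have [[_ hq _] _ _ _ _] := hPqr; exact: cont_cl hq. Qed.

Let acP : ac_derivmx t0 T P dP.
Proof.
have [[[cP0 _] _ _] hdP _ _ _] := hPqr.
suff H : ac_derivmx 0 T P dP by move=> i j; exact: ac_derivS (H i j).
apply: ac_derivmx_smooth => //.
apply: contmxD; last exact: contmxN.
apply: contmxD; last by apply: contmxN; apply: contmxM => //; exact: contmx_tr.
apply: contmxD; last by apply: contmxN; apply: contmxM => //; exact: contmx_tr.
by apply: contmxM => //; apply: contmxM => //; exact: contmx_tr.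
Qed.

Let acq : ac_derivmx t0 T q dq.
Proof.
have [[_ [cq0 _] _] _ hdq _ _] := hPqr.
suff H : ac_derivmx 0 T q dq by move=> i j; exact: ac_derivS (H i j).
apply: ac_derivmx_smooth => //.
apply: contmxD; last by apply: contmxN; apply: contmxM => //; exact: contmx_tr.
by apply: contmxM => //; apply: contmxM => //; exact: contmx_tr.
Qed.

Let acr : ac_deriv t0 T r dr.
Proof.
have [[_ _ [cr0 _]] _ _ hdr _] := hPqr.
suff H : ac_deriv 0 T r dr by exact: ac_derivS H.
apply: ac_deriv_smooth => // t; apply: cvgM; first exact: cvg_cst.
exact: (continuous_bform cq cCpp cq).
Qed.

Let running (x : 'cV[R]_n) (u : 'cV[R]_l) s :=
  2^-1 * bform x (Q s) x + 2^-1 * bform u (Rm s) u + bform x (S s) u.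

Let excess (x : 'cV[R]_n) (u : 'cV[R]_l) s :=
  let v := u - feedback B S Rm P q s x in 2^-1 * bform v (Rm s) v.

(** The product rule produces the left side of [hamilton_jacobi_square]. *)
Let ac_deriv_value x0 x u : trajectory A B T t0 x0 x u ->
  ac_deriv t0 T (fun t => quad (P t) (q t) (r t) (x t))
    (fun t => excess (x t) (u t) t - running (x t) (u t) t).
Proof.
move=> tr; have acx := traj_ac tr.
have h1 := ac_derivmxM t0T (ac_derivmxM t0T (ac_derivmx_tr acx) acP) acx.
have h2 := ac_derivmxM t0T (ac_derivmx_tr acq) acx.
have h3 := ac_derivM t0T (ac_deriv_cst t0 T 2^-1) (h1 0 0).
have h := ac_derivD (ac_derivD h3 (h2 0 0)) acr.
apply: (ac_deriv_ae h); apply: aeW => s st.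
have sT : s \in `[0, T].
  by have := t00; move: st; rewrite !in_itv/= => /andP[s1 s2] ?; apply/andP; split; lra.
have Psym : (P s)^T = P s.
  by have [[[_ +] _ _] _ _ _ _] := hPqr; apply.
have Rpos' : posdefmx (Rm s) by have [_] := hR; apply.
have := hamilton_jacobi_square (A s) (Q s) (B s) (S s) (x s) (q s) (u s) Psym Rpos'.
rewrite /excess /running /feedback => <-.
rewrite mul0r add0r mulmxDl.
have add00 (X Y : 'M[R]_1) : (X + Y) 0 0 = X 0 0 + Y 0 0 by rewrite mxE.
by rewrite !add00.
Qed.

(* [D] is the integral of [excess]. *)
Lemma value_cost x0 x u : L2 t0 T u -> trajectory A B T t0 x0 x u ->
  exists D, [/\ 0 <= D,
    (\int[mu]_(s in `[t0, T])
       (2^-1 * bform (x s) (Q s) (x s) + 2^-1 * bform (u s) (Rm s) (u s)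
        + bform (x s) (S s) (u s))%:E)%E =
      (quad (P t0) (q t0) (r t0) x0 - quad G a b (x T) + D)%:E
    & D = 0 <-> {ae mu, forall t : R, t \in `[t0, T] ->
                   u t = feedback B S Rm P q t (x t)}].
Proof.
move=> L2u tr; have [v hv uv] := L2_sqintmx L2u.
have [_ _ xt0] := tr; have [_ _ _ _ [PT qT rT]] := hPqr.
pose xt t := x (clamp t0 T t); have cx : contmx xt := traj_cont tr.
have xtE t : t \in `[t0, T] -> xt t = x t by move=> tT; rewrite /xt clamp_id.
pose w t := feedback B S Rm P q (cl t) (xt t).
have cw : contmx w.
  apply: contmxN; apply: contmxM => //; apply: contmxD; last first.
    by apply: contmxM => //; exact: contmx_tr.
  apply: contmxD; last by apply: contmxM => //; exact: contmx_tr.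
  by apply: contmxM => //; apply: contmxM => //; exact: contmx_tr.
pose vw t := v t - w t.
have hvw : sqintmx t0 T vw.
  by apply: sqintmxD => //; apply: contmx_sqintmx; exact: contmxN.
have hx : sqintmx t0 T xt by exact: contmx_sqintmx.
(* Excess and running cost, with the control replaced by its Borel representative [v] and the rest
   clamped, which makes both integrable. *)
pose Dt t := 2^-1 * bform (vw t) (Rm (cl t)) (vw t).
pose Lt t := 2^-1 * bform (xt t) (Q (cl t)) (xt t)
  + 2^-1 * bform (v t) (Rm (cl t)) (v t) + bform (xt t) (S (cl t)) (v t).
have mI : measurable (`[t0, T] : set R) by exact: measurable_itv.
have iZ (f : R -> R) : mu.-integrable `[t0, T] (EFin \o f) ->
    mu.-integrable `[t0, T] (EFin \o (fun t => 2^-1 * f t)).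
  by move=> hf; exact: (@integrableZl _ _ _ mu _ mI 2^-1 _ hf).
have iADD (f g : R -> R) : mu.-integrable `[t0, T] (EFin \o f) ->
    mu.-integrable `[t0, T] (EFin \o g) ->
    mu.-integrable `[t0, T] (EFin \o (fun t => f t + g t)).
  by move=> hf hg; exact: (@integrableD _ _ _ mu _ mI _ _ hf hg).
have iD : mu.-integrable `[t0, T] (EFin \o Dt) by apply: (iZ); exact: bform_integrable.
have iL : mu.-integrable `[t0, T] (EFin \o Lt).
  by apply: (iADD); [apply: (iADD); apply: (iZ)|]; exact: bform_integrable.
have fE : ac_deriv t0 T (fun t => quad (P t) (q t) (r t) (x t)) (fun t => Dt t - Lt t).
  apply: (ac_deriv_ae (ac_deriv_value tr)).
  apply: ae_sub uv => t utv tT.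
  have tT' : t \in `[t0, T] by move: tT; rewrite !in_itv/= => /andP[/ltW-> /ltW->].
  by rewrite /Dt /Lt /excess /running /vw /w xtE// clE// utv.
have [acf df] := fE.
have iDL : mu.-integrable `[t0, T] (EFin \o (fun t => Dt t - Lt t)).
  exact: (@integrableB _ _ _ mu _ mI _ _ iD iL).
(* Excess integral minus running cost integral equals terminal value minus initial value. *)
have := abs_continuous_FTC2 t0T acf df iDL.
rewrite RintegralB//.
set D := Rintegral _ _ _ => DE.
have Dt0 t : 0 <= Dt t.
  rewrite /Dt mulr_ge0//; have [_ Rp] := Rpos t.
  have [->|/Rp/ltW//] := eqVneq (vw t) 0.
  by rewrite /bform mulmx0 mxE.
exists D; split.
- by apply: Rintegral_ge0.
- have -> : quad (P t0) (q t0) (r t0) x0 - quad G a b (x T) + D =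
      \int[mu]_(t in `[t0, T]) Lt t.
    by move: DE; rewrite PT qT rT xt0; lra.
  rewrite /Rintegral fineK; last exact: integrable_fin_num.
  (* The control [u] agrees with [v] almost everywhere but may fail to be Borel measurable. *)
  apply: ae_eq_integral_nonmeasurable.
  apply: ae_sub uv => t utv tT.
  by rewrite /Lt xtE// clE// utv.
- have mDt : measurable_fun `[t0, T] (EFin \o Dt) by case/integrableP : iD.
  have DtE : D%:E = (\int[mu]_(t in `[t0, T]) `|(EFin \o Dt) t|)%E.
    rewrite /D /Rintegral fineK; last exact: integrable_fin_num.
    by apply: eq_integral => t _ /=; rewrite ger0_norm.
  (* The nonnegative [Dt] has zero integral exactly when it vanishes almost everywhere; positive
     definiteness of [Rm] then gives [vw t = 0], that is, the feedback law. *)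
  have [ae1 ae2] := @ae_eq_integral_abs _ _ _ mu _ mI _ mDt.
  split=> [D0|uE].
    have aeD : ae_eq mu `[t0, T]%classic (EFin \o Dt) (cst 0%E) by apply: ae1; rewrite -DtE D0.
    apply: ae_sub2 uv aeD => t utv hD tT; have [Dt00] := hD tT.
    rewrite utv//; apply/eqP; rewrite -subr_eq0; apply/negPn/negP => vw0.
    have [_ /(_ (vw t))] := Rpos t.
    move: Dt00; rewrite /Dt => /eqP; rewrite mulf_eq0 invr_eq0 pnatr_eq0/= => /eqP ->.
    by rewrite ltxx /vw /w xtE// clE// => /(_ vw0).
  apply/eqP; rewrite -eqe DtE; apply/eqP/ae2.
  apply: ae_sub2 uv uE => t utv uE tT /=.
  by rewrite /Dt /vw /w xtE// clE// -utv// -uE// subrr /bform mulmx0 mxE mulr0.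
Qed.

(** Substituting the feedback gives an affine equation with continuous coefficients [M] and [c],
    solved by [linear_ode]. *)
Lemma closed_loop x0 : exists x : R -> 'cV[R]_n,
  feasible A B T t0 x0 (x, fun t => feedback B S Rm P q t (x t)).
Proof.
pose M t := A (cl t) - B (cl t) *m invmx (Rm (cl t)) *m
  ((B (cl t))^T *m P (cl t) + (S (cl t))^T).
pose c t := - (B (cl t) *m invmx (Rm (cl t)) *m ((B (cl t))^T *m q (cl t))).
have cM : contmx M.
  apply: contmxD => //; apply: contmxN; apply: contmxM; first exact: contmxM.
  by apply: contmxD; [apply: contmxM => //|]; exact: contmx_tr.
have cc : contmx c.
  apply: contmxN; apply: contmxM; first exact: contmxM.
  by apply: contmxM => //; exact: contmx_tr.
have [x [acx xt0 dx]] := linear_ode x0 t0T cM cc.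
have tr : trajectory A B T t0 x0 x (fun t => feedback B S Rm P q t (x t)).
  split => //; apply: aeW => s; rewrite in_itv/= => /andP[/ltW ts /ltW sT].
  apply: (is_derive_eq (dx s ts sT)).
  rewrite /M /c /feedback clE ?in_itv/= ?ts// mulmxBl mulmxN -addrA -opprD; congr (_ - _).
  by rewrite -!mulmxA -!mulmxDr mulmxDl -!mulmxA addrAC mulmxDr.
exists x; split => //=; first exact: trajectory_L2 tr.
have cx := traj_cont tr.
pose v t := feedback B S Rm P q (cl t) (x (clamp t0 T t)).
apply: (@continuous_L2 _ t0 T _ _ v) => [|t tT]; last by rewrite /v clE// clamp_id.
apply: contmxN; apply: contmxM => //; apply: contmxD; last first.
  by apply: contmxM => //; exact: contmx_tr.
apply: contmxD; last by apply: contmxM => //; exact: contmx_tr.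
by apply: contmxM => //; apply: contmxM => //; exact: contmx_tr.
Qed.

End value_function.

End linear_quadratic.

(** * The terminal minimum and the optimality criterion *)

Section terminal_cost.
Context {R : realType} (n m : nat).
Variables (G : 'I_m.+1 -> 'M[R]_n) (a : 'I_m.+1 -> 'cV[R]_n) (b : 'I_m.+1 -> R).

Lemma Psi_le x i : Psi G a b x <= quad (G i) (a i) (b i) x.
Proof. exact: bigmin_le. Qed.

Lemma Psi_attained x : exists i, Psi G a b x = quad (G i) (a i) (b i) x.
Proof.
rewrite /Psi; apply: (big_ind (fun y => exists i, y = quad (G i) (a i) (b i) x)).
- by exists ord0.
- by move=> _ _ [i ->] [j ->]; rewrite minEle; case: ifP => _; [exists i|exists j].
- by move=> i _; exists i.
Qed.

End terminal_cost.

Theorem proposition2 (R : realType) (n l m : nat) (hn : (0 < n)%N) (hl : (0 < l)%N)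
    (T : R) (hT : 0 < T)
    (A : R -> 'M[R]_n) (B S : R -> 'M[R]_(n, l))
    (Q : R -> 'M[R]_n) (Rm : R -> 'M[R]_l)
    (G : 'I_m.+1 -> 'M[R]_n) (a : 'I_m.+1 -> 'cV[R]_n) (b : 'I_m.+1 -> R)
    (hA : cont_into T setT A) (hB : cont_into T setT B) (hS : cont_into T setT S)
    (hQ : cont_into T (@posdefmx R n) Q) (hR : cont_into T (@posdefmx R l) Rm)
    (hG : forall i, possemidefmx (G i))
    (hCpp : forall t : R, t \in `[0, T] -> possemidefmx (Cpp B Rm t))
    (hCxx : forall t : R, t \in `[0, T] -> posdefmx (Cxx S Q Rm t))
    (P : 'I_m.+1 -> R -> 'M[R]_n) (q : 'I_m.+1 -> R -> 'cV[R]_n)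
    (r : 'I_m.+1 -> R -> R)
    (hPqr : forall i, riccati_solution A B S Q Rm T (G i) (a i) (b i)
                        (P i) (q i) (r i))
    (x0 : 'cV[R]_n) (t0 : R) (ht0 : t0 \in `[0, T])
    (us : R -> 'cV[R]_l) (hus : feasible_control A B T t0 x0 us)
    (xs : R -> 'cV[R]_n) (hxs : trajectory A B T t0 x0 xs us) :
  optimal_control A B S Q Rm G a b T t0 x0 us <->
  exists k : 'I_m.+1,
    (forall i, quad (P k t0) (q k t0) (r k t0) x0
               <= quad (P i t0) (q i t0) (r i t0) x0) /\
    {ae @lebesgue_measure R, forall t : R, t \in `[t0, T] ->
       us t = feedback B S Rm (P k) (q k) t (xs t)}.
Proof.
have T0 := ltW hT; pose J i := quad (P i t0) (q i t0) (r i t0) x0.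
have costE i x u := @value_cost _ _ _ _ _ _ _ _ _ T0 hA hB hS hQ hR _ ht0 _ _ _ _ _ _
  (hPqr i) x0 x u.
(* For an index [j] attaining the terminal minimum the cost equals [J j + D], with [D]
   nonnegative. *)
have cost_ge z (k : 'I_m.+1) : (forall i, J k <= J i) -> feasible A B T t0 x0 z ->
    ((J k)%:E <= cost S Q Rm G a b T t0 z)%E.
  case: z => x u kmin [_ /= L2u tr].
  have [j jE] := Psi_attained G a b (x T).
  have [D [D0 DE _]] := costE j x u L2u tr.
  by rewrite /cost/= DE jE -EFinD lee_fin; have := kmin j; rewrite /J; lra.
(* Under the [k]-th feedback the excess is zero, and [Psi] is at most the [k]-th terminal cost. *)
have cost_le k x u : L2 t0 T u -> trajectory A B T t0 x0 x u ->
    {ae @lebesgue_measure R, forall t : R, t \in `[t0, T] ->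
       u t = feedback B S Rm (P k) (q k) t (x t)} ->
    (cost S Q Rm G a b T t0 (x, u) <= (J k)%:E)%E.
  move=> L2u tr uk; have [D [_ DE [_ /(_ uk) D0]]] := costE k x u L2u tr.
  rewrite /cost/= DE D0 -EFinD lee_fin.
  by have := Psi_le G a b (x T) k; rewrite /J; lra.
have [xu fxu] := hus; have [_ /= L2us _] := fxu.
split=> [[x fx xopt]|[k [kmin uk]]].
  have [_ /= _ trx] := fx.
  have [k kmin] : exists k, forall i, J k <= J i.
    case: (@Order.TotalTheory.arg_minP _ _ _ ord0 xpredT J isT) => k _ kmin.
    by exists k => i; exact: kmin.
  have [y fy] := closed_loop T0 hA hB hS hR ht0 (hPqr k) x0.
  have [_ /= L2y try] := fy.
  have inf_le : (cost S Q Rm G a b T t0 (x, us) <= (J k)%:E)%E.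
    rewrite xopt; apply: le_trans (cost_le k _ _ L2y try (aeW _ (fun t _ => erefl))).
    by apply: ereal_inf_lbound; exists (y, fun t => feedback B S Rm (P k) (q k) t (y t)).
  (* The index sought is one attaining the terminal minimum at [x T], possibly other than [k]:
     $J_j+D\le J_k\le J_j$ forces $D=0$ and $J_j=J_k$. *)
  have [j jE] := Psi_attained G a b (x T).
  have [D [D0 DE [Dj _]]] := costE j x us L2us trx.
  move: inf_le; rewrite /cost/= DE jE -EFinD lee_fin => JjD.
  have Jjk := kmin j.
  exists j; split => [i|]; first by have := kmin i; move: JjD Jjk; rewrite /J; lra.
  have /Dj : D = 0 by apply: le_anti; move: JjD Jjk; rewrite D0 andbT /J; lra.
  apply: ae_sub => t ut tT.
  (* Optimality supplies its own trajectory [x], which uniqueness identifies with [xs]. *)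
  by rewrite -(trajectory_unique T0 hA ht0 trx hxs)// ut.
have fxs : feasible A B T t0 x0 (xs, us).
  by split => //=; exact: trajectory_L2 hxs.
(* Conversely, the cost of [us] is at most [J k], which bounds every feasible cost from below. *)
exists xs => //; apply/eqP; rewrite eq_le; apply/andP; split.
  apply: (le_trans (cost_le k _ _ L2us hxs uk)).
  by apply: le_ereal_inf_tmp => _ [z fz <-]; exact: cost_ge.
by apply: ereal_inf_lbound; exists (xs, us).
Qed.
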